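(* Let $a$ be a symbol, $c$ a constant, and $w$ a fixed word with $|w|=c$. Then the parameterized problem $\mathsf{SimplePath}(a^k w? a^* )$ — given an edge-labeled directed graph $G$, nodes $s,t$, and $k\in\mathbb N$, is there a simple path from $s$ to $t$ whose label is in $L(a^k w? a^* )=\{a^{k}a^{m}\mid m\ge0\}\cup\{a^k w a^m\mid m\ge 0\}$? — is in FPT with parameter $k$.
   Context: A simple path has no repeated nodes; its label is the word of its edge labels. FPT: decidable in time $f(k)\cdot(|G|+k)^{O(1)}$ for a computable $f$. *)

(* Defs.v *)
From mathcomp Require Import all_boot.
Set Implicit Arguments. Unset Strict Implicit. Unset Printing Implicit Defensive.

(* Machine model: deterministic single-tape Turing machines over the    *)
(* tape alphabet {blank, 0, 1} (blank = None), two-way infinite tape.   *)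

Definition tsym := option bool.
Inductive move := MoveL | MoveR | MoveN.

Record TM := {
  tm_Q : finType;
  tm_start : tm_Q;
  tm_acc : tm_Q;
  tm_rej : tm_Q;
  tm_delta : tm_Q -> tsym -> tm_Q * tsym * move
}.

(* configuration: state, left part (reversed, nearest cell first),
   scanned cell, right part; cells not listed are blank *)
Definition config (M : TM) := (tm_Q M * seq tsym * tsym * seq tsym)%type.

Definition tm_halted (M : TM) (q : tm_Q M) : bool :=
  (q == tm_acc M) || (q == tm_rej M).

Definition tm_step (M : TM) (c : config M) : config M :=
  let: (q, l, h, r) := c in
  if tm_halted q then c else
  let: (q', s', mv) := tm_delta q h in
  match mv with
  | MoveN => (q', l, s', r)
  | MoveL => match l with
             | [::] => (q', [::], None, s' :: r)
             | x :: l' => (q', l', x, s' :: r)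
             end
  | MoveR => match r with
             | [::] => (q', s' :: l, None, [::])
             | x :: r' => (q', s' :: l, x, r')
             end
  end.

Definition tm_init (M : TM) (x : seq bool) : config M :=
  match x with
  | [::] => (tm_start M, [::], None, [::])
  | b :: bs => (tm_start M, [::], Some b, map Some bs)
  end.

Definition tm_run (M : TM) (n : nat) (x : seq bool) : config M :=
  iter n (@tm_step M) (tm_init M x).

Definition cfg_state (M : TM) (c : config M) : tm_Q M :=
  let: (q, _, _, _) := c in q.

Definition tm_decides_within (M : TM) (x : seq bool) (T : nat) (ans : Prop) : Prop :=
  exists n, n <= T /\
    let q := cfg_state (tm_run M n x) in tm_halted q /\ (q == tm_acc M <-> ans).

Definition tm_output_unary (M : TM) (c : config M) (v : nat) : Prop :=
  let: (_, _, h, r) := c in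
  exists rest, h :: r = nseq v (Some true) ++ rest /\ head None rest = None.

Definition computable (f : nat -> nat) : Prop :=
  exists M : TM, forall k, exists n,
    cfg_state (tm_run M n (nseq k true)) = tm_acc M /\
    tm_output_unary (tm_run M n (nseq k true)) (f k).

Definition edge (Sigma : finType) := (nat * Sigma * nat)%type.
Definition graph (Sigma : finType) := seq (edge Sigma).

Definition e_src (Sigma : finType) (e : edge Sigma) : nat := e.1.1.
Definition e_lab (Sigma : finType) (e : edge Sigma) : Sigma := e.1.2.
Definition e_tgt (Sigma : finType) (e : edge Sigma) : nat := e.2.

Fixpoint is_walk (Sigma : finType) (G : graph Sigma) (u : nat) (es : seq (edge Sigma)) : bool :=
  match es with
  | [::] => true
  | e :: es' => (e \in G) && (e_src e == u) && is_walk G (e_tgt e) es'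
  end.

Definition walk_nodes (Sigma : finType) (u : nat) (es : seq (edge Sigma)) : seq nat :=
  u :: map (@e_tgt Sigma) es.

Definition simple_path (Sigma : finType) (G : graph Sigma) (s t : nat) (es : seq (edge Sigma)) : Prop :=
  is_walk G s es /\ last s (map (@e_tgt Sigma) es) = t /\ uniq (walk_nodes s es).

Definition path_label (Sigma : finType) (es : seq (edge Sigma)) : seq Sigma :=
  map (@e_lab Sigma) es.

Definition in_lang (Sigma : finType) (a : Sigma) (w : seq Sigma) (k : nat) (u : seq Sigma) : Prop :=
  exists m, u = nseq k a ++ nseq m a \/ u = nseq k a ++ w ++ nseq m a.

Record instance (Sigma : finType) := Inst {
  i_graph : graph Sigma; i_s : nat; i_t : nat; i_k : nat }.

Definition yes_instance (Sigma : finType) (a : Sigma) (w : seq Sigma) (I : instance Sigma) : Prop :=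
  exists es, simple_path (i_graph I) (i_s I) (i_t I) es /\
             in_lang a w (i_k I) (path_label es).

Definition enc_nat (x : nat) : seq bool := rcons (nseq x true) false.

Definition enc_edge (Sigma : finType) (e : edge Sigma) : seq bool :=
  enc_nat (e_src e) ++ enc_nat (enum_rank (e_lab e)) ++ enc_nat (e_tgt e).

Definition enc_instance (Sigma : finType) (I : instance Sigma) : seq bool :=
  enc_nat (i_s I) ++ enc_nat (i_t I) ++ enc_nat (i_k I) ++
  enc_nat (size (i_graph I)) ++ flatten (map (@enc_edge Sigma) (i_graph I)).

Definition FPT_SimplePath (Sigma : finType) (a : Sigma) (w : seq Sigma) : Prop :=
  exists (f : nat -> nat) (c : nat) (M : TM),
    computable f /\
    forall I : instance Sigma,
      let x := enc_instance I in
      tm_decides_within M x (f (i_k I) * (size x + i_k I) ^ c)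
        (yes_instance a w I).

(* Main.v *)
Require Import Defs.
From HB Require Import structures.
From mathcomp Require Import all_boot zify.
From Stdlib Require Import FunctionalExtensionality.
From Stdlib Require Classical_Prop.
Set Implicit Arguments. Unset Strict Implicit. Unset Printing Implicit Defensive.

(** Let [P W R] be a shortest witness, where [P] consists of [k] edges
    labelled [a], [W] is labelled by the empty word or by [w], and [R] is
    labelled by [a]'s.  Colour the vertices so that the [j]-th vertex of [P]
    gets [j] and each of the last [k] vertices of [R] gets [k + 1].  Then no
    [a]-path from [s] that runs through the colours 0, 1, ..., up to [k] and
    avoids [W] meets [R]: its first vertex on [R] is not among the last [k]
    ones, so that following [R] from there gives a shorter witness, whose label
    is a power of [a] with exponent at least [k].  Given [W] and the colouring
    it thus suffices to compute the set [U] of all vertices reached by such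
    coloured paths and to look for a path from [W] to [t] avoiding [U] and [W];
    distinct colours make the coloured paths simple.

    There are polynomially many choices for [W].  At most [2 k + 1] colours
    matter, and [2 k + 1] numbers below [N] are told apart by their bits at
    some [2 k] positions, so the colourings of the following form suffice:
    pack the bits of the vertex at the positions given by a mask below [2 N]
    into a number below [2 ^ (2 k)], and look it up in a table with entries at
    most [k + 1].

    The search is an expression over bit strings built from operations and
    bounded loops that take polynomial time; expressions are compiled to
    programs on finitely many stacks, whose contents a Turing machine keeps one
    after the other on its tape.  Only the bound [2 ^ 2 ^ (3 k + 3)] on the
    number of tables is not polynomial, and it is written on a stack first. *)

(** * Turing machines with several stacks *)

(** The obstacle is to keep prefix and suffix disjoint. [R] has unbounded length, so it cannot be
    coloured entirely. Marking its last [k] vertices is enough: wherever another vertex of [R] is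
    hit, at least [k] edges of [R] remain, so the spliced path still carries at least [k] letters
    [a]. It is shorter because the hit occurs after at most [k] edges, whereas all of [P] and [W]
    precede the vertex that is hit.

    Since the suffix avoids all of [U], no prefix has to be chosen: any coloured path to [W] is
    disjoint from any suffix found. The suffix can be made simple by cutting out loops, as the
    length of its label is free.

    The number [2 k + 1] counts the [k + 1] vertices of [P] and the last [k] of [R]; that [n]
    distinct bit strings are told apart by [n - 1] positions is a form of Bondy's theorem. Trying
    every table on [2 ^ (2 k)] indices takes the place of a family of perfect hash functions. The
    cost is doubly exponential in [k], which is harmless because [f] may be any computable function.
    As [f] must itself be computed by a machine, it is taken from the functions
    [2 ^ 2 ^ (3 k + 3 + D)], where a fixed power of one lies below another. *)

Definition stack_state := nat -> seq bool.

Definition upd (s : stack_state) (i : nat) (v : seq bool) : stack_state :=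
  fun j => if j == i then v else s j.

Lemma upd_same s i v : upd s i v i = v.
Proof. by rewrite /upd eqxx. Qed.

Lemma upd_other s i v j : j != i -> upd s i v j = s j.
Proof. by rewrite /upd => /negbTE ->. Qed.

Inductive instr :=
  | IPush of nat & bool & nat
  | IPop of nat & nat & nat & nat
  | IJmp of nat.

Definition flat_step (code : seq instr) (c : nat * stack_state) : nat * stack_state :=
  let: (pc, s) := c in
  match nth (IJmp pc) code pc with
  | IPush i b n => (n, upd s i (b :: s i))
  | IPop i n0 n1 n2 =>
      match s i with
      | [::] => (n0, s)
      | b :: r => (if b then n2 else n1, upd s i r)
      end
  | IJmp n => (n, s)
  end.

Section Streams.

Variable S : Type.

Definition scons (x : tsym) (f : nat -> tsym) : nat -> tsym :=
  fun n => if n is n'.+1 then f n' else x.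

Definition str (l : seq tsym) : nat -> tsym := nth None l.

Lemma str_nil : str [::] = fun=> None.
Proof. by apply: functional_extensionality => n; rewrite /str nth_nil. Qed.

Lemma str_cons x l : scons x (str l) = str (x :: l).
Proof. by apply: functional_extensionality => -[|n]. Qed.

Lemma str_blank : str [:: None] = str [::].
Proof. by apply: functional_extensionality => -[|[|n]]. Qed.

Lemma str_rcons_blank l : str (rcons l None) = str l.
Proof.
apply: functional_extensionality => n; rewrite /str nth_rcons.
case: ltngtP => // h; first by rewrite nth_default // ltnW.
by rewrite nth_default ?h.
Qed.

(** Half-tapes are streams because lists that differ in trailing blanks denote the same tape; with
    streams, configurations are compared by plain equality. *)
Definition sconfig := (S * (nat -> tsym) * tsym * (nat -> tsym))%type.

Variable delta : S -> tsym -> S * tsym * move.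

Definition sstep (c : sconfig) : sconfig :=
  let: (q, l, h, r) := c in
  let: (q', s', mv) := delta q h in
  match mv with
  | MoveN => (q', l, s', r)
  | MoveL => (q', fun n => l n.+1, l 0, scons s' r)
  | MoveR => (q', scons s' l, r 0, fun n => r n.+1)
  end.

(* The tape [rev A ++ B], scanning the first cell of [B] for [onr] and the
   last cell of [rev A] for [onl]. *)
Definition onr (q : S) (A B : seq tsym) : sconfig :=
  (q, str A, head None B, str (behead B)).
Definition onl (q : S) (A B : seq tsym) : sconfig :=
  (q, str (behead A), head None A, str B).

Lemma onl_onr q x A B : onl q (x :: A) B = onr q A (x :: B).
Proof. by []. Qed.

Lemma onr_blank q A : onr q A [::] = onr q A [:: None].
Proof. by []. Qed.

Lemma str_tail l : (fun n => str l n.+1) = str (behead l).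
Proof. by apply: functional_extensionality => n; case: l => //=; rewrite /str !nth_nil. Qed.

Lemma str_head l : str l 0 = head None l.
Proof. by case: l. Qed.

Lemma sstep_R q q' x y A B :
  delta q x = (q', y, MoveR) -> sstep (onr q A (x :: B)) = onr q' (y :: A) B.
Proof. by move=> E; rewrite /sstep /onr [behead _]/= [head _ _]/= E str_cons str_tail str_head. Qed.

Lemma sstep_L q q' x y A B :
  delta q x = (q', y, MoveL) -> sstep (onl q (x :: A) B) = onl q' A (y :: B).
Proof. by move=> E; rewrite /sstep /onl [behead _]/= [head _ _]/= E str_cons str_tail str_head. Qed.

Lemma sstep_N q q' x y A B :
  delta q x = (q', y, MoveN) -> sstep (onr q A (x :: B)) = onr q' A (y :: B).
Proof. by rewrite /sstep /onr /= => ->. Qed.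

End Streams.

Inductive phase := Start | Seek | Insert | ToEnd | Delete | Home.

Definition nat_of_phase p :=
  match p with Start => 0 | Seek => 1 | Insert => 2 | ToEnd => 3 | Delete => 4 | Home => 5 end.
Definition phase_of_nat n :=
  match n with 0 => Start | 1 => Seek | 2 => Insert | 3 => ToEnd | 4 => Delete | _ => Home end.
Definition ord_of_phase p : 'I_6 := inord (nat_of_phase p).
Definition phase_of_ord (i : 'I_6) := phase_of_nat i.
Lemma ord_of_phaseK : cancel ord_of_phase phase_of_ord.
Proof. by case; rewrite /phase_of_ord /ord_of_phase inordK. Qed.
HB.instance Definition _ := Finite.copy phase (can_type ord_of_phaseK).

(** Program counter and separator counter are plain numbers, so that the simulation is free of
    ordinals; [tm_state] is the finite version. *)
Definition micro_state := (nat * phase * tsym * nat)%type.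

Definition blanks (X : seq tsym) := count (pred1 None) X.

(* [lia] does not identify atoms up to the unfolding of [tsym]. *)
Ltac size_lia := unfold tsym in *; lia.

Section Machine.

Variables (code : seq instr) (m : nat).

Definition acc_state : micro_state := (size code, Start, None, 0).
Definition rej_state : micro_state := ((size code).+1, Start, None, 0).
Definition micro_halted (q : micro_state) := (q == acc_state) || (q == rej_state).

(* The tape lists the contents of the stacks [0 .. m-1], top first, each one
   followed by a blank.  [Insert] shifts the tape to the right starting from
   the top of the stack, [Delete] shifts it to the left coming from the end;
   the third component is the symbol carried, the fourth one is a number of
   separators still to be met. *)
Definition micro (q : micro_state) (h : tsym) : micro_state * tsym * move :=
  let: (pc, ph, c, j) := q in
  let is_blank := h == None in
  match ph with
  | Start =>
      match nth (IJmp pc) code pc with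
      | IPush i _ _ => ((pc, Seek, None, i), h, MoveN)
      | IPop i _ _ _ => ((pc, Seek, None, i), h, MoveN)
      | IJmp n => ((n, Start, None, 0), h, MoveN)
      end
  | Seek =>
      if j is j'.+1 then ((pc, Seek, None, if is_blank then j' else j), h, MoveR)
      else match nth (IJmp pc) code pc with
      | IPush i b _ => ((pc, Insert, Some b, m - i), h, MoveN)
      | IPop i n0 _ _ =>
          if is_blank then ((n0, Home, None, i.+1), h, MoveN)
          else ((pc, ToEnd, None, m - i), h, MoveN)
      | IJmp n => ((n, Start, None, 0), h, MoveN)
      end
  | Insert =>
      if is_blank && (j <= 1) then
        match nth (IJmp pc) code pc with
        | IPush _ _ n => ((n, Home, None, m), c, MoveR)
        | _ => ((pc, Start, None, 0), h, MoveN)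
        end
      else ((pc, Insert, h, j - is_blank), c, MoveR)
  | ToEnd =>
      if is_blank && (j <= 1) then
        match nth (IJmp pc) code pc with
        | IPop i _ _ _ => ((pc, Delete, None, m - i), h, MoveN)
        | _ => ((pc, Start, None, 0), h, MoveN)
        end
      else ((pc, ToEnd, None, j - is_blank), h, MoveR)
  | Delete =>
      if is_blank && (j == 0) then
        match nth (IJmp pc) code pc with
        | IPop i _ n1 n2 =>
            ((if c == Some true then n2 else n1, Home, None, i), h, MoveN)
        | _ => ((pc, Start, None, 0), h, MoveN)
        end
      else ((pc, Delete, h, j - is_blank), c, MoveL)
  | Home =>
      if is_blank && (j == 0) then ((pc, Start, None, 0), h, MoveR)
      else ((pc, Home, None, j - is_blank), h, MoveL)
  end.

Definition hstep (c : sconfig micro_state) : sconfig micro_state :=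
  if micro_halted c.1.1.1 then c else sstep micro c.

Definition reach n c c' := iter n hstep c = c'.

Lemma reach_trans n1 n2 c1 c2 c3 :
  reach n1 c1 c2 -> reach n2 c2 c3 -> reach (n1 + n2) c1 c3.
Proof. by rewrite /reach addnC iterD => -> ->. Qed.

Lemma reach_R q q' x y A B : ~~ micro_halted q ->
  micro q x = (q', y, MoveR) -> reach 1 (onr q A (x :: B)) (onr q' (y :: A) B).
Proof. by move=> h E; rewrite /reach -[iter _ _ _]/(hstep _) /hstep ifN // (sstep_R _ _ E). Qed.

Lemma reach_L q q' x y A B : ~~ micro_halted q ->
  micro q x = (q', y, MoveL) -> reach 1 (onl q (x :: A) B) (onl q' A (y :: B)).
Proof. by move=> h E; rewrite /reach -[iter _ _ _]/(hstep _) /hstep ifN // (sstep_L _ _ E). Qed.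

Lemma reach_N q q' x y A B : ~~ micro_halted q ->
  micro q x = (q', y, MoveN) -> reach 1 (onr q A (x :: B)) (onr q' A (y :: B)).
Proof. by move=> h E; rewrite /reach -[iter _ _ _]/(hstep _) /hstep ifN // (sstep_N _ _ E). Qed.

Lemma running_phase pc ph c j : ph <> Start -> ~~ micro_halted (pc, ph, c, j).
Proof.
move/eqP=> h; rewrite /micro_halted /acc_state /rej_state !xpair_eqE (negbTE h).
by rewrite !andbF.
Qed.

Lemma running_pc pc ph c j : pc < size code -> ~~ micro_halted (pc, ph, c, j).
Proof.
move=> h; rewrite /micro_halted /acc_state /rej_state !xpair_eqE.
by rewrite (ltn_eqF h) (ltn_eqF (leqW h)).
Qed.

(** [X] has to end in a separator: the counter then drops to [j] exactly at its last cell, and the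
    seek cannot stop inside [X] even for [j = 0]. *)
Lemma reach_seek pc j X A B : last None X = None ->
  reach (size X) (onr (pc, Seek, None, blanks X + j) A (X ++ B))
                 (onr (pc, Seek, None, j) (rev X ++ A) B).
Proof.
elim: X A => [|x X IH] A lastX; first exact: erefl.
have lastX' : last None X = None by case: X lastX {IH}.
rewrite rev_cons cat_rcons -[size _]add1n.
apply: reach_trans (IH (x :: A) lastX'); apply: reach_R; first exact: running_phase.
rewrite /= /micro; case E: (blanks (x :: X) + j) => [|j'].
  have: None \in x :: X by have := mem_last x X; rewrite -[last x X]/(last None (x :: X)) lastX.
  by rewrite -has_pred1 has_count -/(blanks _); lia.
by move: E; rewrite /blanks /=; case: x {lastX} => [b|] /=; rewrite ?add0n ?add1n => E;
  congr ((_, _, _, _), _, _); lia.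
Qed.

(** The counter exceeds the separators of [X] by one, for the final blank. That cell receives the
    last symbol carried, and the fresh blank to its right becomes the new final separator. *)
Lemma reach_insert pc i b n X A c : nth (IJmp pc) code pc = IPush i b n ->
  reach (size X).+1 (onr (pc, Insert, c, (blanks X).+1) A (rcons X None))
                    (onr (n, Home, None, m) (rev (c :: X) ++ A) [:: None]).
Proof.
move=> code_pc; elim: X A c => [|x X IH] A c.
  by rewrite -onr_blank; apply: reach_R; [exact: running_phase | rewrite /micro /= code_pc].
rewrite rev_cons cat_rcons -[(size _).+1]add1n.
apply: reach_trans (IH _ _); apply: reach_R; first exact: running_phase.
rewrite /micro /blanks /=.
by case: x => [b'|] /=; congr ((_, _, _, _), _, _); lia.
Qed.

Lemma reach_end pc i n0 n1 n2 X A : nth (IJmp pc) code pc = IPop i n0 n1 n2 ->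
  reach (size X).+1 (onr (pc, ToEnd, None, (blanks X).+1) A (rcons X None))
                    (onr (pc, Delete, None, m - i) (rev X ++ A) [:: None]).
Proof.
move=> code_pc; elim: X A => [|x X IH] A.
  by apply: reach_N; [exact: running_phase | rewrite /micro /= code_pc].
rewrite rev_cons cat_rcons -[(size _).+1]add1n.
apply: reach_trans (IH _); apply: reach_R; first exact: running_phase.
rewrite /micro /blanks /=.
by case: x => [b'|] /=; congr ((_, _, _, _), _, _); lia.
Qed.

(** Going left, each cell receives its right neighbour's symbol. On reaching the blank before the
    stack, the symbol carried is thus the former top, which selects the jump. *)
Lemma reach_delete pc i n0 n1 n2 Y A B c : nth (IJmp pc) code pc = IPop i n0 n1 n2 ->
  reach (size Y).+1
    (onl (pc, Delete, c, blanks Y) (Y ++ None :: A) B)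
    (onl (if last c Y == Some true then n2 else n1, Home, None, i)
         (None :: A) (rev (belast c Y) ++ B)).
Proof.
move=> code_pc; elim: Y B c => [|y Y IH] B c.
  by rewrite !onl_onr; apply: reach_N; [exact: running_phase | rewrite /micro /= code_pc].
rewrite /= rev_cons cat_rcons -[(size _).+2]add1n.
apply: reach_trans (IH _ _); apply: reach_L; first exact: running_phase.
rewrite /micro /blanks /=.
by case: y => [b'|] /=; congr ((_, _, _, _), _, _); lia.
Qed.

(** The counter accounts for every separator in [Y], so the blank met at counter 0 is the cell to
    the left of the whole tape. *)
Lemma reach_home pc Y B :
  reach (size Y).+1 (onl (pc, Home, None, blanks Y) Y B)
                    (onr (pc, Start, None, 0) [::] (rev Y ++ B)).
Proof.
elim: Y B => [|y Y IH] B.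
  have -> : onl (pc, Home, None, blanks [::]) [::] B =
            onr (pc, Home, None, 0) [::] (None :: B) by [].
  have -> : onr (pc, Start, None, 0) [::] (rev [::] ++ B) =
            onr (pc, Start, None, 0) [:: None] B by rewrite /onr str_blank.
  by apply: reach_R; first exact: running_phase.
rewrite /= rev_cons cat_rcons -[(size _).+2]add1n.
apply: reach_trans (IH _); apply: reach_L; first exact: running_phase.
rewrite /micro /blanks /=.
by case: y => [b'|] /=; congr ((_, _, _, _), _, _); lia.
Qed.

Definition block (b : seq bool) : seq tsym := rcons (map Some b) None.

Definition layout (s : stack_state) (i n : nat) : seq tsym :=
  flatten [seq block (s x) | x <- iota i n].

Lemma layoutD s i n1 n2 : layout s i (n1 + n2) = layout s i n1 ++ layout s (i + n1) n2.
Proof. by rewrite /layout iotaD map_cat flatten_cat. Qed.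

Lemma layoutS s i n : layout s i n.+1 = block (s i) ++ layout s i.+1 n.
Proof. by []. Qed.

Lemma layout1 s i : layout s i 1 = block (s i).
Proof. by rewrite layoutS cats0. Qed.

Lemma blanks_cat X Y : blanks (X ++ Y) = blanks X + blanks Y.
Proof. exact: count_cat. Qed.

Lemma blanks_rev X : blanks (rev X) = blanks X.
Proof. exact: count_rev. Qed.

Lemma blanks_block b : blanks (block b) = 1.
Proof.
by rewrite /block -cats1 blanks_cat /= addn0 (_ : blanks _ = 0) //; elim: b.
Qed.

Lemma blanks_layout s i n : blanks (layout s i n) = n.
Proof.
elim: n i => [|n IH] i //.
by rewrite layoutS blanks_cat blanks_block IH.
Qed.

Lemma last_layout s i n : last None (layout s i n) = None.
Proof.
case: n => // n; rewrite -addn1 layoutD last_cat layout1.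
by rewrite last_rcons.
Qed.

Lemma layout_rcons s i n : exists X : seq tsym, layout s i n.+1 = rcons X None.
Proof.
exists (layout s i n ++ map Some (s (i + n))).
by rewrite -addn1 layoutD layout1 rcons_cat.
Qed.

Lemma eq_layout s s' i n : (forall x, i <= x < i + n -> s x = s' x) ->
  layout s i n = layout s' i n.
Proof.
by move=> E; congr flatten; apply/eq_in_map => x; rewrite mem_iota => /E ->.
Qed.

Lemma layout_split s i v : i < m ->
  layout (upd s i v) 0 m = layout s 0 i ++ block v ++ layout s i.+1 (m - i.+1).
Proof.
move=> lim; have E : m = i + (m - i.+1).+1 by lia.
rewrite {1}E layoutD layoutS upd_same add0n.
congr (_ ++ (_ ++ _)); apply: eq_layout => x hx; rewrite upd_other //; lia.
Qed.

Lemma onl_rcons_blank (q : micro_state) A B : onl q (rcons A None) B = onl q A B.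
Proof. by case: A => [|a A]; rewrite /onl //= str_rcons_blank. Qed.

Lemma onr_rcons_blank (q : micro_state) A B : onr q A (rcons B None) = onr q A B.
Proof. by case: B => [|a B]; rewrite /onr //= str_rcons_blank. Qed.

Lemma reach_stay q q' A B : ~~ micro_halted q ->
  micro q (head None B) = (q', head None B, MoveN) -> reach 1 (onr q A B) (onr q' A B).
Proof. by case: B => [|x B] h E; [rewrite !onr_blank|]; apply: reach_N h E. Qed.

Definition home (pc : nat) s : sconfig micro_state := onr (pc, Start, None, 0) [::] (layout s 0 m).

Definition total (s : stack_state) := size (layout s 0 m).

Lemma pc_in_code pc c : nth (IJmp pc) code pc = c -> c <> IJmp pc -> pc < size code.
Proof. by move=> <-; case: ltnP => // h; rewrite nth_default. Qed.

Lemma reach_push pc i b n s : nth (IJmp pc) code pc = IPush i b n -> i < m ->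
  reach (2 * total s + 4) (home pc s) (home n (upd s i (b :: s i))).
Proof.
move=> code_pc lim; have pc_lt: pc < size code by apply: (pc_in_code code_pc).
have split_s : layout s 0 m = layout s 0 i ++ layout s i (m - i).
  by rewrite -{1}(subnKC (ltnW lim)) layoutD.
have := blanks_layout s i (m - i); have := split_s; rewrite /home /total.
have -> : m - i = (m - i.+1).+1 by size_lia.
case: (layout_rcons s i (m - i.+1)) => X' E; rewrite E => -> blX'.
set X := layout s 0 i; have blX : blanks X = i by exact: blanks_layout.
have blX'' : (blanks X').+1 = m - i by move: blX'; rewrite -cats1 blanks_cat /=; size_lia.
have -> : 2 * size (X ++ rcons X' None) + 4 =
   1 + (size X + (1 + ((size X').+1 + (size (None :: (rev (Some b :: X') ++ rev X))).+1))).
  by rewrite /= !size_cat !size_rev size_rcons /=; size_lia.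
apply: (reach_trans (c2 := onr (pc, Seek, None, blanks X + 0) [::] (X ++ rcons X' None))).
  by apply: reach_stay; [exact: running_pc | rewrite /micro code_pc blX addn0].
apply: reach_trans (reach_seek _ _ _ _ (last_layout _ _ _)) _; rewrite cats0.
apply: (reach_trans (c2 := onr (pc, Insert, Some b, (blanks X').+1) (rev X) (rcons X' None))).
  by apply: reach_stay; [exact: running_pc | rewrite /micro code_pc blX''].
apply: reach_trans (reach_insert _ _ _ code_pc) _.
have blY : blanks (None :: (rev (Some b :: X') ++ rev X)) = m.
  by rewrite /= /blanks /= -/(blanks _) blanks_cat !blanks_rev /blanks /= -!/(blanks _); size_lia.
rewrite -onl_onr -[X in onl (_, _, _, X)]blY.
have -> : layout (upd s i (b :: s i)) 0 m =
   rev (None :: (rev (Some b :: X') ++ rev X)) ++ [::]; last exact: reach_home.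
rewrite layout_split // cats0 rev_cons rev_cat !revK -/X -cats1 -catA /= cats1 -E.
by rewrite layoutS -?catA.
Qed.

Lemma reach_pop_nil pc i n0 n1 n2 s :
  nth (IJmp pc) code pc = IPop i n0 n1 n2 -> i < m -> s i = [::] ->
  exists2 t, t <= 2 * total s + 4 & reach t (home pc s) (home n0 s).
Proof.
move=> code_pc lim si; have pc_lt: pc < size code by apply: (pc_in_code code_pc).
have split_s : layout s 0 m = layout s 0 i ++ None :: layout s i.+1 (m - i.+1).
  have {1}-> : m = i + (m - i.+1).+1 by size_lia.
  by rewrite layoutD layoutS si.
rewrite /home /total split_s; set X := layout s 0 i; set Z := layout _ _ _.
have blX : blanks X = i by exact: blanks_layout.
exists (1 + (size X + (1 + (size (None :: rev X)).+1))).
  by rewrite /= !size_cat !size_rev /=; size_lia.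
apply: (reach_trans (c2 := onr (pc, Seek, None, blanks X + 0) [::] (X ++ None :: Z))).
  by apply: reach_stay; [exact: running_pc | rewrite /micro code_pc blX addn0].
apply: reach_trans (reach_seek _ _ _ _ (last_layout _ _ _)) _; rewrite cats0.
apply: (reach_trans (c2 := onr (n0, Home, None, blanks (None :: rev X)) (rev X) (None :: Z))).
  apply: reach_stay; [exact: running_pc | rewrite /micro code_pc /=].
  by rewrite /blanks /= -/(blanks _) blanks_rev blX.
rewrite -onl_onr; have -> : X ++ None :: Z = rev (None :: rev X) ++ Z.
  by rewrite rev_cons revK cat_rcons.
exact: reach_home.
Qed.

Lemma reach_pop_cons pc i n0 n1 n2 s b r :
  nth (IJmp pc) code pc = IPop i n0 n1 n2 -> i < m -> s i = b :: r ->
  exists2 t, t <= 2 * total s + 6 &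
    reach t (home pc s) (home (if b then n2 else n1) (upd s i r)).
Proof.
move=> code_pc lim si; have pc_lt: pc < size code by apply: (pc_in_code code_pc).
have [X' E] : exists X' : seq tsym, block r ++ layout s i.+1 (m - i.+1) = rcons X' None.
  have [X' E] := layout_rcons s i (m - i.+1); rewrite layoutS si in E.
  by case: X' E => [|x X'] //= [_ E]; exists X'.
have split_s : layout s 0 m = layout s 0 i ++ Some b :: rcons X' None.
  have {1}-> : m = i + (m - i.+1).+1 by size_lia.
  by rewrite layoutD layoutS si -E.
have blX' : (blanks X').+1 = m - i.
  have := congr1 blanks E; rewrite blanks_cat blanks_block blanks_layout.
  by rewrite -cats1 blanks_cat /=; size_lia.
rewrite /home /total split_s layout_split // E; set X := layout s 0 i.
have blX : blanks X = i by exact: blanks_layout.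
pose Y := None :: rev (Some b :: X').
have blY : blanks Y = m - i.
  by rewrite /Y /blanks /= -/(blanks _) blanks_rev /blanks /= -/(blanks _); size_lia.
exists (1 + (size X + (1 + ((size (Some b :: X')).+1 + ((size Y).+1 + (size (rev X)).+1))))).
  by rewrite /Y /= !size_cat !size_rev /= size_rcons; size_lia.
apply: (reach_trans (c2 := onr (pc, Seek, None, blanks X + 0) [::] (X ++ Some b :: rcons X' None))).
  by apply: reach_stay; [exact: running_pc | rewrite /micro code_pc blX addn0].
apply: reach_trans (reach_seek _ _ _ _ (last_layout _ _ _)) _; rewrite cats0.
apply: (reach_trans
  (c2 := onr (pc, ToEnd, None, (blanks (Some b :: X')).+1) (rev X) (rcons (Some b :: X') None))).
  apply: reach_stay; [exact: running_pc | rewrite /micro code_pc /=].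
  by rewrite /blanks /= -/(blanks _) blX'.
apply: reach_trans (reach_end _ _ code_pc) _; rewrite -blY -onl_onr.
(* Stack 0 has no separator to its left; there a blank from beyond the left end of the tape plays
   its role. *)
have [A EA EA'] : exists2 A, forall (q : micro_state) B, onl q (Y ++ rev X) B = onl q (Y ++ None :: A) B
                       & forall (q : micro_state) B, onl q (None :: A) B = onl q (rev X) B.
  rewrite /X; case: (i) => [|i']; last first.
    by case: (layout_rcons s 0 i') => X1 ->; exists (rev X1); rewrite rev_rcons.
  by exists [::] => q B //; rewrite cats0 cats1 onl_rcons_blank.
rewrite -[None :: _]/(Y ++ rev X) EA.
apply: reach_trans (reach_delete _ _ _ _ code_pc) _; rewrite EA' cats0 -[i in onl (_, _, _, i)]blX -(blanks_rev X).
have -> : (last None Y == Some true) = b by rewrite /Y rev_cons last_cons last_rcons; case: (b).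
(* The shift leaves one extra blank at the right end, which does not change the tape. *)
have -> : rev (belast None Y) = rcons (rcons X' None) None.
  by rewrite /Y rev_cons -rcons_cons belast_rcons !rev_cons revK.
rewrite -[onr _ _ (X ++ _)]onr_rcons_blank rcons_cat.
by have := reach_home (if b then n2 else n1) (rev X) (rcons (rcons X' None) None); rewrite revK.
Qed.

End Machine.

(** * From stack programs to a Turing machine *)

Section Simulation.

Variables (code : seq instr) (m : nat).

(** Two addresses beyond the code are legal: [size code] is the accepting exit and its successor the
    rejecting one. *)
Definition target_bound := (size code).+2.

Definition well_formed (c : instr) :=
  match c with
  | IPush i _ n => (i < m) && (n < target_bound)
  | IPop i n0 n1 n2 =>
      [&& i < m, n0 < target_bound, n1 < target_bound & n2 < target_bound]
  | IJmp n => n < target_bound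
  end.

Hypothesis wf_code : all well_formed code.

Lemma wf_nth pc : pc < target_bound -> well_formed (nth (IJmp pc) code pc).
Proof.
move=> h; case: (ltnP pc (size code)) => h'; last by rewrite nth_default.
exact: (all_nthP _ wf_code).
Qed.

Lemma total_upd s i v : i < m ->
  total m (upd s i v) + size (s i) = total m s + size v.
Proof.
move=> lim; have s_upd : layout s 0 m = layout (upd s i (s i)) 0 m.
  by apply: eq_layout => x _; rewrite /upd; case: eqP => [->|].
rewrite /total s_upd !layout_split // !size_cat !size_rcons !size_map; lia.
Qed.

Lemma simulate_step pc s : pc < target_bound ->
  let c := flat_step code (pc, s) in
  [/\ c.1 < target_bound, total m c.2 <= (total m s).+1 &
    exists2 t, t <= 2 * total m s + 6 & reach code m t (home m pc s) (home m c.1 c.2)].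
Proof.
move=> pc_lt; case: (ltnP pc (size code)) => pc_lt'; last first.
  by rewrite /= nth_default //; split=> //; exists 0.
have := wf_nth pc_lt; rewrite /=; case E: (nth _ _ _) => [i b n|i n0 n1 n2|n] /= wf.
- have [lim n_lt] := andP wf; split=> //.
    by have := total_upd s (b :: s i) lim => /=; lia.
  by eexists; last exact: reach_push E lim; lia.
- have /and4P[lim n0_lt n1_lt n2_lt] := wf.
  case si : (s i) => [|b r] /=; split=> //.
  + by have [t h1 h2] := reach_pop_nil E lim si; exists t => //; lia.
  + by case: (b).
  + by have := total_upd s r lim; rewrite si /=; lia.
  + exact: (reach_pop_cons E lim si).
- split=> //; exists 1; first lia.
  by apply: reach_stay; [exact: running_pc | rewrite /micro E].
Qed.

(** An instruction lengthens the tape by at most one cell and costs a number of moves linear in its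
    length, hence the quadratic overhead. *)
Lemma simulate n pc s : pc < target_bound ->
  let c := iter n (flat_step code) (pc, s) in
  exists2 t, t <= n * (2 * (total m s + n) + 6) &
    reach code m t (home m pc s) (home m c.1 c.2).
Proof.
elim: n pc s => [|n IH] pc s pc_lt; first by exists 0.
rewrite iterSr; have [] := simulate_step s pc_lt.
case: (flat_step _ _) => pc' s' /= pc'_lt tot [t1 t1_le r1].
have [t2 t2_le r2] := IH pc' s' pc'_lt.
by exists (t1 + t2); [nia | exact: reach_trans r1 r2].
Qed.

Definition tm_state := ('I_target_bound * phase * tsym * 'I_m.+2)%type.

Definition embed (q : tm_state) : micro_state :=
  let: (pc, ph, c, j) := q in (val pc, ph, c, val j).
Definition project (q : micro_state) : tm_state :=
  let: (pc, ph, c, j) := q in (inord pc, ph, c, inord j).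

Definition in_range (q : micro_state) :=
  let: (pc, _, _, j) := q in (pc < target_bound) && (j < m.+2).

Lemma projectK q : in_range q -> embed (project q) = q.
Proof. by case: q => [[[pc ph] c] j] /andP[h1 h2]; rewrite /= !inordK. Qed.

Lemma embed_inj : injective embed.
Proof.
by move=> [[[pc ph] c] j] [[[pc' ph'] c'] j'] [] /val_inj -> -> -> /val_inj ->.
Qed.

Lemma embed_in_range q : in_range (embed q).
Proof. by case: q => [[[pc ph] c] j] /=; rewrite !ltn_ord. Qed.

Lemma micro_in_range q h : in_range q -> in_range (micro code m q h).1.1.
Proof.
case: q => [[[pc ph] c] j] /andP[pc_lt j_lt]; have := wf_nth pc_lt.
case: ph; rewrite /micro.
- by case: (nth _ _ _) => [i b n|i n0 n1 n2|n] /=; lia.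
- case: j j_lt => [|j] j_lt; last by case: (h == None) => /=; lia.
  case: (nth _ _ _) => [i b n|i n0 n1 n2|n] /=; try lia.
  by case: (h == None) => /=; lia.
- case: ifP => _; last by rewrite /=; lia.
  by case: (nth _ _ _) => [i b n|i n0 n1 n2|n] /=; lia.
- case: ifP => _; last by rewrite /=; lia.
  by case: (nth _ _ _) => [i b n|i n0 n1 n2|n] /=; lia.
- case: ifP => _; last by rewrite /=; lia.
  case: (nth _ _ _) => [i b n|i n0 n1 n2|n] /=; try lia.
  by case: (c == Some true); lia.
- by case: ifP => _ /=; lia.
Qed.

Definition machine : TM := {|
  tm_start := project (0, Start, None, 0);
  tm_acc := project (acc_state code);
  tm_rej := project (rej_state code);
  tm_delta := fun q h => let: (q', s', mv) := micro code m (embed q) h in (project q', s', mv)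
|}.

Definition stream_config (c : config machine) : sconfig micro_state :=
  let: (q, l, h, r) := c in (embed q, str l, h, str r).

Lemma eq_project (q : tm_state) (p : micro_state) : in_range p -> (q == project p) = (embed q == p).
Proof. by move=> p_in; rewrite -{2}(projectK p_in) (inj_eq embed_inj). Qed.

Lemma embed_halted q : tm_halted (M := machine) q = micro_halted code (embed q).
Proof.
by rewrite /tm_halted /micro_halted !eq_project //= ?ltnSn // leqnSn.
Qed.

Lemma embed_accepting (q : tm_Q machine) :
  (q == tm_acc machine) = (embed q == acc_state code).
Proof. by rewrite eq_project //= /target_bound ltnS leqnSn. Qed.

Lemma stream_step c : stream_config (tm_step c) = hstep code m (stream_config c).
Proof.
case: c => [[[q l] h] r]; rewrite /tm_step /hstep /= embed_halted.
case: ifP => // _; have := micro_in_range h (embed_in_range q).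
case E: (micro _ _ _ _) => [[q' s'] mv] /= in_q'.
case: mv E => _ /=; last by rewrite projectK.
- by case: l => [|x l] /=; rewrite projectK // str_cons ?str_nil.
- by case: r => [|x r] /=; rewrite projectK // str_cons ?str_nil.
Qed.

Lemma stream_run n x :
  stream_config (tm_run machine n x) =
  iter n (hstep code m) (stream_config (tm_init machine x)).
Proof. by rewrite /tm_run; elim: n => //= n <-; rewrite stream_step. Qed.

Definition input_state (x : seq bool) : stack_state := upd (fun=> [::]) 0 x.

Lemma layout_nil i n : layout (fun=> [::]) i n = nseq n None.
Proof. by elim: n i => //= n IH i; rewrite layoutS IH. Qed.

Lemma str_nseq_blank l n : str (l ++ nseq n None) = str l.
Proof.
elim: n l => [|n IH] l; first by rewrite cats0.
by rewrite -cat_rcons IH str_rcons_blank.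
Qed.

(** The tape needs no preparation: separators are blanks, so the bare input is already the layout
    with all stacks but the first empty. *)
Lemma stream_init x : 0 < m -> stream_config (tm_init machine x) = home m 0 (input_state x).
Proof.
move=> m_gt0; rewrite /home.
have -> : layout (input_state x) 0 m = map Some x ++ nseq (m - 1).+1 None.
  by rewrite /input_state layout_split // !layout_nil /block cat_rcons.
have E : embed (project (0, Start, None, 0)) = (0, Start, None, 0) by rewrite projectK.
case: x => [|b x]; rewrite /stream_config /tm_init E /onr [behead _]/= [head _ _]/=.
  by rewrite -[nseq _ _]cat0s str_nseq_blank.
by rewrite -[None :: nseq _ _]/(nseq (m - 1).+1 None) str_nseq_blank.
Qed.

Lemma total_input x : 0 < m -> total m (input_state x) = m + size x.
Proof.
move=> m_gt0; have := total_upd (fun=> [::]) x m_gt0.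
by rewrite /total layout_nil size_nseq addn0.
Qed.

Lemma machine_run x n pc s : 0 < m ->
  iter n (flat_step code) (0, input_state x) = (pc, s) ->
  exists2 t, t <= n * (2 * (m + size x + n) + 6) &
    stream_config (tm_run machine t x) = home m pc s.
Proof.
move=> m_gt0 E; have [//|t] := @simulate n 0 (input_state x); rewrite E total_input //= => t_le r.
by exists t; rewrite // stream_run stream_init.
Qed.

End Simulation.

(** * Structured stack programs and their assembly *)

Inductive cmd :=
  | CSkip
  | CPush of nat & bool
  | CPop of nat & cmd & cmd & cmd
  | CSeq of cmd & cmd
  | CWhile of nat & cmd & cmd.

Inductive runs : cmd -> stack_state -> stack_state -> nat -> Prop :=
  | runs_skip s : runs CSkip s s 1
  | runs_push i b s : runs (CPush i b) s (upd s i (b :: s i)) 1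
  | runs_pop_nil i c0 cf ct s s' n : s i = [::] ->
      runs c0 s s' n -> runs (CPop i c0 cf ct) s s' n.+1
  | runs_pop_cons i c0 cf ct s b r s' n : s i = b :: r ->
      runs (if b then ct else cf) (upd s i r) s' n -> runs (CPop i c0 cf ct) s s' n.+1
  | runs_seq c1 c2 s s1 s2 n1 n2 :
      runs c1 s s1 n1 -> runs c2 s1 s2 n2 -> runs (CSeq c1 c2) s s2 (n1 + n2)
  | runs_while_nil i cf ct s : s i = [::] -> runs (CWhile i cf ct) s s 1
  | runs_while_cons i cf ct s b r s1 s2 n1 n2 : s i = b :: r ->
      runs (if b then ct else cf) (upd s i r) s1 n1 ->
      runs (CWhile i cf ct) s1 s2 n2 -> runs (CWhile i cf ct) s s2 (n1 + n2).+1.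

Fixpoint code_size (c : cmd) : nat :=
  match c with
  | CSkip | CPush _ _ => 1
  | CPop _ c0 cf ct => (code_size c0 + code_size cf + code_size ct).+1
  | CSeq c1 c2 => code_size c1 + code_size c2
  | CWhile _ cf ct => (code_size cf + code_size ct).+1
  end.

(** The code sits at address [start] and leaves to address [stop]; a loop body therefore gets the
    address of the loop test as its [stop]. *)
Fixpoint assemble (c : cmd) (start stop : nat) : seq instr :=
  match c with
  | CSkip => [:: IJmp stop]
  | CPush i b => [:: IPush i b stop]
  | CPop i c0 cf ct =>
      let l0 := start.+1 in
      let lf := l0 + code_size c0 in
      let lt := lf + code_size cf in
      IPop i l0 lf lt :: assemble c0 l0 stop ++ assemble cf lf stop ++ assemble ct lt stop
  | CSeq c1 c2 =>
      let l := start + code_size c1 in assemble c1 start l ++ assemble c2 l stop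
  | CWhile i cf ct =>
      let lf := start.+1 in
      let lt := lf + code_size cf in
      IPop i stop lf lt :: assemble cf lf start ++ assemble ct lt start
  end.

Lemma size_assemble c start stop : size (assemble c start stop) = code_size c.
Proof.
elim: c start stop => //=.
- by move=> i c0 IH0 cf IHf ct IHt *; rewrite !size_cat IH0 IHf IHt addnA.
- by move=> c1 IH1 c2 IH2 *; rewrite size_cat IH1 IH2.
- by move=> i cf IHf ct IHt *; rewrite size_cat IHf IHt.
Qed.

Definition code_at (code part : seq instr) (pc : nat) :=
  exists pre post, code = pre ++ part ++ post /\ size pre = pc.

Lemma code_at_cat code p1 p2 pc :
  code_at code (p1 ++ p2) pc -> code_at code p1 pc /\ code_at code p2 (pc + size p1).
Proof.
move=> [pre [post [-> <-]]]; split.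
  by exists pre, (p2 ++ post); rewrite !catA.
by exists (pre ++ p1), post; rewrite size_cat !catA.
Qed.

Lemma code_at_cons code c p pc :
  code_at code (c :: p) pc -> nth (IJmp pc) code pc = c /\ code_at code p pc.+1.
Proof.
rewrite -cat1s => /code_at_cat[[pre [post [-> <-]]]]; rewrite addn1; split=> //.
by rewrite nth_cat ltnn subnn.
Qed.

Lemma assemble_correct c s s' n code start stop :
  runs c s s' n -> code_at code (assemble c start stop) start ->
  iter n (flat_step code) (start, s) = (stop, s').
Proof.
move=> r; elim: r start stop => {c s s' n}.
- by move=> s start stop /code_at_cons[/= -> _].
- by move=> i b s start stop /code_at_cons[/= -> _].
- move=> i c0 cf ct s s' n si _ IH start stop /code_at_cons[E /code_at_cat[at0 _]].
  by rewrite iterSr /= E si; apply: IH.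
- move=> i c0 cf ct s b r s' n si _ IH start stop /code_at_cons[E].
  move=> /code_at_cat[_]; rewrite size_assemble => /code_at_cat[atf].
  by rewrite size_assemble => att; rewrite iterSr /= E si; case: b IH si => IH si; apply: IH.
- move=> c1 c2 s s1 s2 n1 n2 _ IH1 _ IH2 start stop /code_at_cat[at1].
  by rewrite size_assemble => at2; rewrite addnC iterD (IH1 _ _ at1) (IH2 _ _ at2).
- by move=> i cf ct s si start stop /code_at_cons[E _] /=; rewrite E si.
- move=> i cf ct s b r s1 s2 n1 n2 si _ IH1 _ IH2 start stop at_while.
  have [E /code_at_cat[atf]] := code_at_cons at_while; rewrite size_assemble => att.
  rewrite iterSr /= E si addnC iterD.
  have -> : iter n1 (flat_step code)
     (if b then start.+1 + code_size cf else start.+1, upd s i r) = (start, s1).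
    by case: b IH1 {si} => IH1; apply: IH1.
  exact: IH2.
Qed.

Fixpoint index_bound (c : cmd) : nat :=
  match c with
  | CSkip => 0
  | CPush i _ => i.+1
  | CPop i c0 cf ct => maxn i.+1 (maxn (index_bound c0) (maxn (index_bound cf) (index_bound ct)))
  | CSeq c1 c2 => maxn (index_bound c1) (index_bound c2)
  | CWhile i cf ct => maxn i.+1 (maxn (index_bound cf) (index_bound ct))
  end.

Lemma assemble_wf code m c start stop : index_bound c <= m -> stop < target_bound code ->
  start + code_size c < target_bound code -> all (well_formed code m) (assemble c start stop).
Proof.
elim: c start stop => /=.
- by move=> start stop _ ->.
- by move=> i b start stop -> ->.
- move=> i c0 IH0 cf IHf ct IHt start stop bd st sz.
  rewrite /= !all_cat; apply/and4P; split; [lia | apply: IH0 | apply: IHf | apply: IHt]; lia.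
- move=> c1 IH1 c2 IH2 start stop bd st sz.
  by rewrite all_cat; apply/andP; split; [apply: IH1 | apply: IH2]; lia.
- move=> i cf IHf ct IHt start stop bd st sz.
  by rewrite /= all_cat; apply/and3P; split; [lia | apply: IHf | apply: IHt]; lia.
Qed.

Section Decide.

Variables (c : cmd) (r : nat).

(** The last instruction tests the result stack [r]: if it is nonempty, control passes to the
    address equal to the length of the code, which accepts, and otherwise to the next one, which
    rejects. *)
Definition program_code : seq instr :=
  let n := code_size c in
  assemble c 0 n ++ [:: IPop r n.+2 n.+1 n.+1].

Definition stack_count := maxn (index_bound c) r.+1.

Definition program_machine : TM := machine program_code stack_count.

Lemma size_program_code : size program_code = (code_size c).+1.
Proof. by rewrite size_cat size_assemble addn1. Qed.

Lemma program_wf : all (well_formed program_code stack_count) program_code.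
Proof.
rewrite [X in all _ X]/program_code all_cat; apply/andP; split.
  by apply: assemble_wf; rewrite ?leq_maxl // /target_bound size_program_code ltnW.
by rewrite /= /target_bound size_program_code !ltnS leqnn leqnSn leq_maxr.
Qed.

Lemma program_machine_run x s n : runs c (input_state x) s n ->
  exists2 t, t <= n.+1 * (2 * (stack_count + size x + n.+1) + 6) &
    stream_config (tm_run program_machine t x) =
    home stack_count (if s r is [::] then (code_size c).+2 else (code_size c).+1)
         (upd s r (behead (s r))).
Proof.
move=> run; apply: machine_run; [exact: program_wf | exact: leq_trans (leq_maxr _ _) |].
rewrite iterS; set code := program_code.
rewrite (assemble_correct (code := code) (start := 0) (stop := code_size c) run); last first.
  by exists [::], [:: IPop r (code_size c).+2 (code_size c).+1 (code_size c).+1].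
rewrite /flat_step /code /program_code nth_cat size_assemble ltnn subnn /=.
case E: (s r) => [|b v] /=; last by case: b {E}.
congr pair; apply: functional_extensionality => j; rewrite /upd.
by case: eqP => // ->.
Qed.

Lemma program_decides x s n T (ans : Prop) : runs c (input_state x) s n ->
  n.+1 * (2 * (stack_count + size x + n.+1) + 6) <= T ->
  (s r != [::] <-> ans) -> tm_decides_within program_machine x T ans.
Proof.
move=> /program_machine_run[t t_le E] T_ge ans_iff; exists t; split; first exact: leq_trans T_ge.
have sz := size_program_code.
move: E; case: (tm_run _ _ _) => [[[q l] h] r'] [Eq _ _ _].
rewrite /cfg_state; cbv zeta.
rewrite embed_halted embed_accepting Eq.
rewrite /micro_halted /acc_state /rej_state sz -ans_iff !xpair_eqE !andbT.
by case: (s r) => [|b v]; rewrite !eqxx ?orbT //= !eqSS gtn_eqF.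
Qed.

End Decide.

(** On halting, the head is on the first cell of the tape, where stack 0 begins, and the separator
    ends the unary number. [r] must not be 0 because the final test pops [r]. *)
Lemma program_outputs c r x s n v : runs c (input_state x) s n ->
  s 0 = nseq v true -> s r != [::] -> r != 0 ->
  exists t, cfg_state (tm_run (program_machine c r) t x) = tm_acc (program_machine c r) /\
            tm_output_unary (tm_run (program_machine c r) t x) v.
Proof.
move=> /(program_machine_run r)[t _ E] s0 sr r_gt0; exists t; move: E.
case: (tm_run _ _ _) => [[[q l] h] r']; rewrite /home.
set s' := upd _ _ _; set m := stack_count c r.
have [Z ->] : exists Z, layout s' 0 m = block (nseq v true) ++ Z.
  have -> : m = (m - 1).+1 by rewrite subn1 prednK // /m leq_max orbT.
  by rewrite layoutS /s' upd_other 1?eq_sym // s0; eexists.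
move=> [Eq _ Eh Er]; split.
  apply/eqP; rewrite -[_ == _]/(q == _) embed_accepting Eq /acc_state size_program_code.
  by case: (s r) sr.
have Ehr i : i <= v -> nth None (h :: r') i = nth None (block (nseq v true)) i.
  move=> i_le; have := congr1 (fun f => scons h f i) Er; rewrite str_cons {1}/str => ->.
  have -> : scons h (str (behead (block (nseq v true) ++ Z))) =
            str (block (nseq v true) ++ Z).
    by rewrite Eh str_cons; case: (v).
  by rewrite /str nth_cat size_rcons size_map size_nseq ltnS i_le.
exists (drop v (h :: r')); split; last first.
  by rewrite -nth0 nth_drop addn0 Ehr // nth_rcons size_map size_nseq ltnn eqxx.
rewrite -{1}(cat_take_drop v (h :: r')); congr (_ ++ _).
have nth_true i : i < v -> nth None (h :: r') i = Some true.
  move=> lt_iv; rewrite Ehr ?(ltnW lt_iv) // nth_rcons size_map size_nseq lt_iv.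
  by rewrite (nth_map false) ?size_nseq // nth_nseq lt_iv.
(* The list of cells is known only up to trailing blanks, but a nonblank cell must lie inside it. *)
have v_le : v <= size (h :: r').
  case: leqP => // lt; have := nth_true _ lt.
  by rewrite nth_default.
apply: (@eq_from_nth _ None); rewrite size_takel ?size_nseq // => i lt_iv.
by rewrite nth_take // nth_nseq lt_iv nth_true.
Qed.

Definition cruns c s s' B := exists2 n, n <= B & runs c s s' n.

Lemma cruns_le c s s' B B' : B <= B' -> cruns c s s' B -> cruns c s s' B'.
Proof. by move=> h [n n_le r]; exists n => //; apply: leq_trans h. Qed.

Lemma cruns_seq c1 c2 s s1 s2 B1 B2 :
  cruns c1 s s1 B1 -> cruns c2 s1 s2 B2 -> cruns (CSeq c1 c2) s s2 (B1 + B2).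
Proof.
move=> [n1 h1 r1] [n2 h2 r2]; exists (n1 + n2); first exact: leq_add.
exact: runs_seq r1 r2.
Qed.

Lemma cruns_skip s : cruns CSkip s s 1.
Proof. by exists 1 => //; exact: runs_skip. Qed.

Lemma cruns_push i b s : cruns (CPush i b) s (upd s i (b :: s i)) 1.
Proof. by exists 1 => //; exact: runs_push. Qed.

Lemma cruns_pop i c0 cf ct s s' B :
  match s i with
  | [::] => cruns c0 s s' B
  | b :: r => cruns (if b then ct else cf) (upd s i r) s' B
  end -> cruns (CPop i c0 cf ct) s s' B.+1.
Proof.
case E: (s i) => [|b r] [n n_le run]; exists n.+1 => //.
  exact: runs_pop_nil.
exact: runs_pop_cons E run.
Qed.

Fixpoint loop (A : Type) (f : bool -> seq bool -> A -> A) (v : seq bool) (a : A) : A :=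
  if v is b :: v' then loop f v' (f b v' a) else a.

(** Loop rule: [st v a] is the state with [v] left on the control stack and abstract data [a], [f]
    is the effect of one pass on the data, and [ok] is the invariant. *)
Lemma cruns_while A (ok : seq bool -> A -> Prop) (st : seq bool -> A -> stack_state)
    (f : bool -> seq bool -> A -> A) i cf ct K :
  (forall v a, st v a i = v) ->
  (forall b v a, ok (b :: v) a -> ok v (f b v a) /\
     cruns (if b then ct else cf) (upd (st (b :: v) a) i v) (st v (f b v a)) K) ->
  forall v a, ok v a ->
  cruns (CWhile i cf ct) (st v a) (st [::] (loop f v a)) (size v * K.+1).+1.
Proof.
move=> st_i step; elim=> [|b v IH] a ok_a.
  by exists 1 => //; apply: runs_while_nil; rewrite st_i.
have [ok_a' [n1 n1_le r1]] := step _ _ _ ok_a.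
have [n2 n2_le r2] := IH _ ok_a'.
exists (n1 + n2).+1; first by rewrite /= mulSn; lia.
exact: runs_while_cons (st_i _ _) r1 r2.
Qed.

Ltac state_eq :=
  let z := fresh "z" in
  apply: functional_extensionality => z; rewrite /upd;
  repeat match goal with |- context [?x == ?y] => case: (x =P y) => ? end;
  subst; rewrite ?eqxx //; try lia; try congruence.

Definition transfer i j := CWhile i (CPush j false) (CPush j true).

Lemma loop_cons v (a : seq bool) : loop (fun b _ a => b :: a) v a = rev v ++ a.
Proof. by elim: v a => //= b v IH a; rewrite IH rev_cons cat_rcons. Qed.

Lemma cruns_transfer (i j : nat) s : i != j ->
  cruns (transfer i j) s (upd (upd s i [::]) j (rev (s i) ++ s j)) (2 * size (s i)).+1.
Proof.
move=> neq; pose st v a := upd (upd s i v) j a.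
have -> : s = st (s i) (s j) by rewrite /st; state_eq.
have -> : upd (upd (st (s i) (s j)) i [::]) j (rev (st (s i) (s j) i) ++ st (s i) (s j) j) =
   st [::] (loop (fun b _ a => b :: a) (s i) (s j)).
  by rewrite loop_cons /st upd_same upd_other // upd_same; state_eq.
have -> : 2 * size (st (s i) (s j) i) = size (s i) * 2.
  by rewrite mulnC /st upd_other // upd_same.
apply: (cruns_while (ok := fun _ _ => True)) => // [v a|b v a _].
  by rewrite /st upd_other // upd_same.
split=> //; have -> : st v (b :: a) =
    upd (upd (st (b :: v) a) i v) j (b :: upd (st (b :: v) a) i v j).
  by rewrite (upd_other _ _ (_ : j != i)) 1?eq_sym // /st upd_same; state_eq.
by case: b; exact: cruns_push.
Qed.

Definition clear i := CWhile i CSkip CSkip.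

Lemma cruns_clear i s : cruns (clear i) s (upd s i [::]) (2 * size (s i)).+1.
Proof.
pose st v (a : unit) := upd s i v.
have -> : s = st (s i) tt by rewrite /st; state_eq.
have -> : upd (st (s i) tt) i [::] = st [::] (loop (fun _ _ a => a) (s i) tt).
  by rewrite /st; state_eq.
have -> : 2 * size (st (s i) tt i) = size (s i) * 2 by rewrite mulnC /st upd_same.
apply: (cruns_while (ok := fun _ _ => True)) => // [v a|b v a _].
  by rewrite /st upd_same.
split=> //; have -> : st v a = upd (st (b :: v) a) i v by rewrite /st; state_eq.
by case: b; exact: cruns_skip.
Qed.

(** * Polynomial-time expressions *)

(* Numbers are represented by the lengths of bit strings and truth values by
   non-emptiness.  In [EFor x n b] the variable [x] runs over the proper
   suffixes of the value of [n], shortest first, and the values of [b] are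
   concatenated; in [EIter x y n i c b] the suffixes are taken longest first
   and the accumulator [y], initially [i], is cut at the length of [c]. *)
Inductive expr :=
  | EVar of nat
  | ENil
  | ECons of bool & expr
  | ECat of expr & expr
  | EDrop of expr & expr
  | EHd of expr
  | EIf of expr & expr & expr
  | ELet of nat & expr & expr
  | EFor of nat & expr & expr
  | EIter of nat & nat & expr & expr & expr & expr.

Fixpoint concat_loop (f : seq bool -> seq bool) (v : seq bool) : seq bool :=
  if v is _ :: v' then concat_loop f v' ++ f v' else [::].

Fixpoint iter_loop (f : seq bool -> seq bool -> seq bool) (v acc : seq bool) : seq bool :=
  if v is _ :: v' then iter_loop f v' (f v' acc) else acc.

Fixpoint ev (e : expr) (env : stack_state) : seq bool :=
  match e with
  | EVar x => env x
  | ENil => [::]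
  | ECons b e => b :: ev e env
  | ECat a b => ev a env ++ ev b env
  | EDrop n a => drop (size (ev n env)) (ev a env)
  | EHd a => if ev a env is true :: _ then [:: true] else [::]
  | EIf c a b => if ev c env is [::] then ev b env else ev a env
  | ELet x a b => ev b (upd env x (ev a env))
  | EFor x n b => concat_loop (fun v => ev b (upd env x v)) (ev n env)
  | EIter x y n i c b =>
      iter_loop (fun v acc => take (size (ev c env)) (ev b (upd (upd env x v) y acc)))
        (ev n env) (ev i env)
  end.

(** A transfer reverses its source. A variable is therefore read by moving it aside and then back
    onto two stacks at once, which restores the order and yields a copy. *)
Definition split_transfer i j k :=
  CWhile i (CSeq (CPush j false) (CPush k false)) (CSeq (CPush j true) (CPush k true)).

Definition truncate i j k :=
  CWhile i (CPop j CSkip (CPush k false) (CPush k true))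
           (CPop j CSkip (CPush k false) (CPush k true)).

Definition drop_cmd i j := CWhile i (CPop j CSkip CSkip CSkip) (CPop j CSkip CSkip CSkip).

Definition bind (rho : nat -> nat) (x i : nat) : nat -> nat :=
  fun z => if z == x then i else rho z.

(* The variable [x] is stored in the stack [rho x], the stacks from [d] on are
   free, and the value computed is left in the stack [d]. *)
Fixpoint comp (e : expr) (rho : nat -> nat) (d : nat) : cmd :=
  match e with
  | EVar x => CSeq (transfer (rho x) d.+1) (split_transfer d.+1 (rho x) d)
  | ENil => CSkip
  | ECons b e => CSeq (comp e rho d) (CPush d b)
  | ECat a b =>
      CSeq (comp b rho d) (CSeq (comp a rho d.+1)
        (CSeq (transfer d.+1 d.+2) (transfer d.+2 d)))
  | EDrop n a => CSeq (comp a rho d) (CSeq (comp n rho d.+1) (drop_cmd d.+1 d))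
  | EHd a =>
      CSeq (comp a rho d) (CPop d CSkip (clear d) (CSeq (clear d) (CPush d true)))
  | EIf c a b =>
      let then_ := CSeq (clear d) (comp a rho d) in
      CSeq (comp c rho d) (CPop d (comp b rho d) then_ then_)
  | ELet x a b =>
      CSeq (comp a rho d) (CSeq (comp b (bind rho x d) d.+1)
        (CSeq (clear d) (CSeq (transfer d.+1 d.+2) (transfer d.+2 d))))
  | EFor x n b =>
      let body := CSeq (comp b (bind rho x d) d.+2)
        (CSeq (transfer d.+2 d.+3) (transfer d.+3 d.+1)) in
      CSeq (comp n rho d) (CSeq (CWhile d body body)
        (CSeq (transfer d.+1 d.+2) (transfer d.+2 d)))
  | EIter x y n i c b =>
      let body := CSeq (comp b (bind (bind rho x d) y d.+1) d.+2)
        (CSeq (clear d.+1) (CSeq (comp c rho d.+3)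
        (CSeq (truncate d.+3 d.+2 d.+4) (CSeq (clear d.+2) (transfer d.+4 d.+1))))) in
      CSeq (comp n rho d) (CSeq (comp i rho d.+1) (CSeq (CWhile d body body)
        (CSeq (transfer d.+1 d.+2) (transfer d.+2 d))))
  end.

Definition small (env : stack_state) B := forall x, size (env x) <= B.

Lemma small_upd env B x v : small env B -> size v <= B -> small (upd env x v) B.
Proof. by move=> env_B v_B z; rewrite /upd; case: eqP. Qed.

Lemma small_leq env B B' : B <= B' -> small env B -> small env B'.
Proof. by move=> le env_B x; apply: leq_trans le. Qed.

Lemma leq_expn B a b : 2 <= B -> a <= b -> B ^ a <= B ^ b.
Proof. by move=> B_ge; rewrite leq_exp2l. Qed.

(** Since [B] is at least 2, the constant [512 = 2 ^ 9] costs 9 in the exponent; all cost estimates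
    below are brought into this shape. *)
Lemma absorb B M t : 2 <= B -> t <= 512 * (B ^ M * B ^ M) -> t <= B ^ (9 + (M + M)).
Proof.
move=> B_ge t_le; apply: leq_trans t_le _; rewrite !expnD leq_mul // -[512]/(2 ^ 9).
by rewrite leq_exp2r.
Qed.

Lemma size_concat_loop f v K : (forall w, size w <= size v -> size (f w) <= K) ->
  size (concat_loop f v) <= size v * K.
Proof.
elim: v => //= b v IH f_K; rewrite size_cat mulSn addnC leq_add //.
  by apply: f_K; exact: leqnSn.
by apply: IH => w w_le; apply: f_K; exact: leqW.
Qed.

Lemma size_iter_loop f v acc K : (forall w acc, size (f w acc) <= K) -> size acc <= K ->
  size (iter_loop f v acc) <= K.
Proof. by move=> f_K; elim: v acc => //= b v IH acc acc_K; apply: IH. Qed.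

(** Under a binder the environment is bounded by a power of [B], so exponents multiply. In an
    iteration this would happen in every pass; the cut at the size of [c] prevents it. *)
Lemma ev_size e : exists C, forall env B, 2 <= B -> small env B -> size (ev e env) <= B ^ C.
Proof.
elim: e => /=.
- by move=> x; exists 1 => env B _ env_B; rewrite expn1.
- by exists 0.
- move=> b e [C IH]; exists C.+1 => env B B_ge env_B /=.
  have := IH env B B_ge env_B; have : 0 < B ^ C by rewrite expn_gt0; lia.
  by rewrite expnS; nia.
- move=> a [Ca IHa] b [Cb IHb]; exists (maxn Ca Cb).+1 => env B B_ge env_B /=.
  rewrite size_cat expnS; have := IHa env B B_ge env_B; have := IHb env B B_ge env_B.
  have := leq_expn B_ge (leq_maxl Ca Cb); have := leq_expn B_ge (leq_maxr Ca Cb); nia.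
- move=> n _ a [C IH]; exists C => env B B_ge env_B /=.
  by rewrite size_drop; apply: leq_trans (leq_subr _ _) (IH _ _ _ _).
- move=> a _; exists 0 => env B _ _ /=.
  by case: (ev a env) => [|[] l].
- move=> c _ a [Ca IHa] b [Cb IHb]; exists (maxn Ca Cb) => env B B_ge env_B /=.
  case: (ev c env) => [|_ _].
    exact: leq_trans (IHb _ _ B_ge env_B) (leq_expn B_ge (leq_maxr Ca Cb)).
  exact: leq_trans (IHa _ _ B_ge env_B) (leq_expn B_ge (leq_maxl Ca Cb)).
- move=> x a [Ca IHa] b [Cb IHb]; exists (Ca.+1 * Cb) => env B B_ge env_B.
  have B_le : B <= B ^ Ca.+1 by rewrite -{1}(expn1 B) leq_expn.
  rewrite expnM; apply: IHb; first exact: leq_trans B_le.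
  apply: small_upd; first exact: small_leq B_le env_B.
  by apply: leq_trans (IHa _ _ B_ge env_B) _; exact: leq_expn.
- move=> x n [Cn IHn] b [Cb IHb]; exists (Cn + Cn.+1 * Cb) => env B B_ge env_B.
  have B_le : B <= B ^ Cn.+1 by rewrite -{1}(expn1 B) leq_expn.
  have n_le := IHn _ _ B_ge env_B.
  rewrite expnD; apply: leq_trans (size_concat_loop (K := B ^ (Cn.+1 * Cb)) _) _.
    move=> w w_le; rewrite expnM; apply: IHb; first exact: leq_trans B_le.
    apply: small_upd; first exact: small_leq B_le env_B.
    by apply: leq_trans w_le _; apply: leq_trans n_le _; exact: leq_expn.
  by rewrite leq_mul2r n_le orbT.
- move=> x y n _ i [Ci IHi] c [Cc IHc] b _; exists (maxn Ci Cc) => env B B_ge env_B.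
  apply: size_iter_loop.
    move=> w acc; rewrite size_take_min; apply: leq_trans (geq_minl _ _) _.
    exact: leq_trans (IHc _ _ B_ge env_B) (leq_expn B_ge (leq_maxr Ci Cc)).
  exact: leq_trans (IHi _ _ B_ge env_B) (leq_expn B_ge (leq_maxl Ci Cc)).
Qed.

Lemma cruns_push2 (j k : nat) b s : j != k ->
  cruns (CSeq (CPush j b) (CPush k b)) s (upd (upd s j (b :: s j)) k (b :: s k)) 2.
Proof.
move=> jk; have := cruns_push k b (upd s j (b :: s j)); rewrite upd_other 1?eq_sym //.
exact: (cruns_seq (cruns_push _ _ _)).
Qed.

Lemma cruns_split_transfer i j k s : i != j -> i != k -> j != k ->
  cruns (split_transfer i j k) s
    (upd (upd (upd s i [::]) j (rev (s i) ++ s j)) k (rev (s i) ++ s k))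
    (3 * size (s i)).+1.
Proof.
move=> ij ik jk; pose st v (a : seq bool * seq bool) := upd (upd (upd s i v) j a.1) k a.2.
pose f (b : bool) (_ : seq bool) a : seq bool * seq bool := (b :: a.1, b :: a.2).
have loopE v a : loop f v a = (rev v ++ a.1, rev v ++ a.2).
  by elim: v a => [|b v IH] [a1 a2] //=; rewrite IH rev_cons !cat_rcons.
have s_st : s = st (s i) (s j, s k) by rewrite /st /=; state_eq.
have -> : upd (upd (upd s i [::]) j (rev (s i) ++ s j)) k (rev (s i) ++ s k) =
   st [::] (loop f (s i) (s j, s k)) by rewrite loopE.
rewrite {1}s_st mulnC; apply: (cruns_while (ok := fun _ _ => True)) => // [v a|b v a _].
  by rewrite /st upd_other // upd_other // upd_same.
split=> //; set s' := upd (st (b :: v) a) i v.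
have -> : st v (f b v a) = upd (upd s' j (b :: s' j)) k (b :: s' k).
  have -> : s' j = a.1 by rewrite /s' upd_other 1?eq_sym // /st upd_other // upd_same.
  have -> : s' k = a.2 by rewrite /s' upd_other 1?eq_sym // /st upd_same.
  by rewrite /s' /st /f /=; state_eq.
by case: (b); apply: cruns_push2.
Qed.

Lemma cruns_drop i j s : i != j ->
  cruns (drop_cmd i j) s (upd (upd s i [::]) j (drop (size (s i)) (s j))) (3 * size (s i)).+1.
Proof.
move=> ij; pose st v a := upd (upd s i v) j a.
pose f (_ : bool) (_ : seq bool) (a : seq bool) := behead a.
have loopE v a : loop f v a = drop (size v) a.
  by elim: v a => [|b v IH] a /=; [rewrite drop0 | rewrite IH /f; case: a].
have s_st : s = st (s i) (s j) by rewrite /st; state_eq.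
rewrite -[upd _ _ _]/(st [::] _) -loopE {1}s_st mulnC.
apply: (cruns_while (ok := fun _ _ => True)) => // [v a|b v a _].
  by rewrite /st upd_other // upd_same.
split=> //; have pop : cruns (CPop j CSkip CSkip CSkip) (upd (st (b :: v) a) i v) (st v (f b v a)) 2.
  apply: cruns_pop; have -> : upd (st (b :: v) a) i v = st v a by rewrite /st; state_eq.
  have -> : st v a j = a by rewrite /st upd_same.
  case: a => [|b' a] /=; first exact: cruns_skip.
  have -> : upd (st v (b' :: a)) j a = st v a by rewrite /st; state_eq.
  by case: b'; exact: cruns_skip.
by case: b pop.
Qed.

Lemma cruns_truncate i j k s : i != j -> i != k -> j != k -> s k = [::] ->
  cruns (truncate i j k) s
    (upd (upd (upd s i [::]) j (drop (size (s i)) (s j))) k (rev (take (size (s i)) (s j))))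
    (3 * size (s i)).+1.
Proof.
move=> ij ik jk sk; pose st v (a : seq bool * seq bool) := upd (upd (upd s i v) j a.1) k a.2.
pose f (_ : bool) (_ : seq bool) (a : seq bool * seq bool) :=
  if a.1 is b :: r then (r, b :: a.2) else a.
have loopE v a : loop f v a = (drop (size v) a.1, rev (take (size v) a.1) ++ a.2).
  elim: v a => [|b v IH] [a1 a2] /=; first by rewrite drop0 take0.
  by rewrite IH /f; case: a1 => [|b' a1] //=; rewrite rev_cons cat_rcons.
have s_st : s = st (s i) (s j, [::]) by rewrite /st /=; state_eq.
have -> : upd (upd (upd s i [::]) j (drop (size (s i)) (s j))) k (rev (take (size (s i)) (s j))) =
   st [::] (loop f (s i) (s j, [::])) by rewrite loopE cats0.
rewrite {1}s_st mulnC; apply: (cruns_while (ok := fun _ _ => True)) => // [v a|b v a _].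
  by rewrite /st upd_other // upd_other // upd_same.
split=> //; have pop : cruns (CPop j CSkip (CPush k false) (CPush k true))
    (upd (st (b :: v) a) i v) (st v (f b v a)) 2.
  apply: cruns_pop; have -> : upd (st (b :: v) a) i v = st v a by rewrite /st; state_eq.
  have -> : st v a j = a.1 by rewrite /st upd_other // upd_same.
  case: a => [[|b' a1] a2] /=; first exact: cruns_skip.
  have -> : st v (a1, b' :: a2) = upd (upd (st v (b' :: a1, a2)) j a1) k
     (b' :: upd (st v (b' :: a1, a2)) j a1 k).
    by rewrite (upd_other _ _ (_ : k != j)) 1?eq_sym // /st upd_same /=; state_eq.
  by case: b'; exact: cruns_push.
by case: b pop.
Qed.

(** * Compiled expressions run in polynomial time *)

Definition represents (rho : nat -> nat) d (env s : stack_state) :=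
  (forall x, rho x < d /\ s (rho x) = env x) /\ (forall j, d <= j -> s j = [::]).

Lemma represents_shift rho d d' env s s' : represents rho d env s -> d <= d' ->
  (forall j, j < d -> s' j = s j) -> (forall j, d' <= j -> s' j = [::]) ->
  represents rho d' env s'.
Proof.
move=> [var _] le_d same free; split=> // x; have [lt_x E] := var x.
by rewrite same // (leq_trans lt_x le_d).
Qed.

Lemma represents_bind rho d env s x i v : represents rho d env s -> i < d -> s i = v ->
  represents (bind rho x i) d (upd env x v) s.
Proof.
move=> [var free] lt_i si; split=> // z.
by rewrite /bind /upd; case: eqP => // _; split.
Qed.

Definition comp_cost e C := forall rho d s env B, 2 <= B -> small env B ->
  represents rho d env s -> cruns (comp e rho d) s (upd s d (ev e env)) (B ^ C).

Lemma comp_cost_leq e C C' : C <= C' -> comp_cost e C -> comp_cost e C'.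
Proof.
move=> le_C cost rho d s env B B_ge env_B rep.
exact: cruns_le (leq_expn B_ge le_C) (cost _ _ _ _ _ B_ge env_B rep).
Qed.

Lemma cruns_eq c s s1 s2 B B' : cruns c s s1 B -> s1 = s2 -> B <= B' -> cruns c s s2 B'.
Proof. by move=> r <- le; apply: cruns_le r. Qed.

Lemma upd_at s i v j : i = j -> upd s i v j = v.
Proof. by move=> ->; rewrite upd_same. Qed.

(* Evaluates the contents of explicitly indexed stacks, given that those from
   [d] on are empty initially. *)
Ltac lookup free :=
  repeat match goal with
  | |- context [upd ?s ?i ?v ?j] =>
      first [rewrite (@upd_at s i v j); [|lia] | rewrite (@upd_other s i v j); [|lia]]
  | |- context [_ ?j] => rewrite (free j); [|lia]
  end.

Lemma cruns_move (i k j : nat) s : i != k -> i != j -> k != j -> s k = [::] ->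
  cruns (CSeq (transfer i k) (transfer k j)) s
        (upd (upd s i [::]) j (s i ++ s j)) (4 * size (s i)).+2.
Proof.
move=> ik ij kj sk; have r1 := cruns_transfer s ik; have r2 := cruns_transfer _ kj.
have free : forall z, z = k -> s z = [::] by move=> z ->.
apply: cruns_eq (cruns_seq r1 (r2 _)) _ _; lookup free; rewrite cats0 ?revK.
  by state_eq.
by rewrite size_rev; lia.
Qed.

Lemma cost_var x : exists C, comp_cost (EVar x) C.
Proof.
exists (9 + (1 + 1)) => rho d s env B B_ge env_B [var free]; have [lt_x sx] := var x.
have x_B := env_B x.
have r1 := @cruns_transfer (rho x) d.+1 s ltac:(lia).
have r2 := @cruns_split_transfer d.+1 (rho x) d _ ltac:(lia) ltac:(lia) ltac:(lia).
apply: cruns_eq (cruns_seq r1 (r2 _)) _ _; lookup free; rewrite !cats0 ?revK /= sx.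
  by state_eq; rewrite free.
by apply: absorb => //; rewrite size_rev expn1; nia.
Qed.

Lemma cost_cons b e C : comp_cost e C -> comp_cost (ECons b e) C.+1.
Proof.
move=> cost rho d s env B B_ge env_B rep.
apply: cruns_eq (cruns_seq (cost _ _ _ _ _ B_ge env_B rep) (cruns_push _ _ _)) _ _.
  by rewrite upd_same; state_eq.
have : 0 < B ^ C by rewrite expn_gt0; lia.
by rewrite expnS; nia.
Qed.

Lemma cost_cat a b C : comp_cost a C -> comp_cost b C ->
  (forall env B, 2 <= B -> small env B -> size (ev a env) <= B ^ C) ->
  comp_cost (ECat a b) (9 + (C + C)).
Proof.
move=> costa costb size_a rho d s env B B_ge env_B rep; have [var free] := rep.
have r1 := costb _ _ _ _ _ B_ge env_B rep.
have rep1 : represents rho d.+1 env (upd s d (ev b env)).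
  by apply: represents_shift rep _ _ _ => // j le_j; lookup free.
have r2 := costa _ _ _ _ _ B_ge env_B rep1.
have r3 := @cruns_move d.+1 d.+2 d _ ltac:(lia) ltac:(lia) ltac:(lia).
apply: cruns_eq (cruns_seq r1 (cruns_seq r2 (r3 _ _))) _ _; lookup free => //.
  by state_eq; rewrite free.
have a_le := size_a _ _ B_ge env_B.
have : 0 < B ^ C by rewrite expn_gt0; lia.
by move=> *; apply: absorb => //; nia.
Qed.

Definition size_poly e C := forall env B, 2 <= B -> small env B -> size (ev e env) <= B ^ C.

Lemma size_poly_leq e C C' : C <= C' -> size_poly e C -> size_poly e C'.
Proof.
move=> le_C size_e env B B_ge env_B.
exact: leq_trans (size_e _ _ B_ge env_B) (leq_expn B_ge le_C).
Qed.

Lemma cost_drop n a C : comp_cost n C -> comp_cost a C -> size_poly n C ->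
  comp_cost (EDrop n a) (9 + (C + C)).
Proof.
move=> costn costa size_n rho d s env B B_ge env_B rep; have [var free] := rep.
have r1 := costa _ _ _ _ _ B_ge env_B rep.
have rep1 : represents rho d.+1 env (upd s d (ev a env)).
  by apply: represents_shift rep _ _ _ => // j le_j; lookup free.
have r2 := costn _ _ _ _ _ B_ge env_B rep1.
have r3 := @cruns_drop d.+1 d _ ltac:(lia).
apply: cruns_eq (cruns_seq r1 (cruns_seq r2 (r3 _))) _ _; lookup free => //.
  by state_eq; rewrite free //; lia.
have n_le := size_n _ _ B_ge env_B.
have : 0 < B ^ C by rewrite expn_gt0; lia.
by move=> *; apply: absorb => //; nia.
Qed.

Lemma cost_hd a C : comp_cost a C -> size_poly a C -> comp_cost (EHd a) (9 + (C + C)).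
Proof.
move=> costa size_a rho d s env B B_ge env_B rep; have [var free] := rep.
have r1 := costa _ _ _ _ _ B_ge env_B rep.
have a_le := size_a _ _ B_ge env_B.
have X_gt0 : 0 < B ^ C by rewrite expn_gt0; lia.
apply: (@cruns_le _ _ _ (B ^ C + (2 * size (ev a env) + 2).+1)); first by apply: absorb => //; nia.
apply: cruns_seq r1 _; apply: cruns_pop; rewrite upd_same /=.
case: (ev a env) => [|[] v] /=.
- exact: cruns_le (cruns_skip _).
- apply: cruns_eq (cruns_seq (cruns_clear _ _) (cruns_push _ _ _)) _ _; rewrite !upd_same.
    by state_eq.
  by rewrite /=; lia.
- apply: cruns_eq (cruns_clear _ _) _ _; rewrite ?upd_same; first by state_eq.
  by rewrite /=; lia.
Qed.

Lemma cost_if c a b C : comp_cost c C -> comp_cost a C -> comp_cost b C -> size_poly c C ->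
  comp_cost (EIf c a b) (9 + (C + C)).
Proof.
move=> costc costa costb size_c rho d s env B B_ge env_B rep; have [var free] := rep.
have r1 := costc _ _ _ _ _ B_ge env_B rep.
have c_le := size_c _ _ B_ge env_B.
have X_gt0 : 0 < B ^ C by rewrite expn_gt0; lia.
apply: (@cruns_le _ _ _ (B ^ C + ((2 * size (ev c env)).+1 + B ^ C).+1)).
  by apply: absorb => //; nia.
apply: cruns_seq r1 _; apply: cruns_pop; rewrite upd_same /=.
have stE v w : upd (upd s d v) d w = upd s d w by state_eq.
have same v : v = [::] -> upd s d v = s by move=> ->; state_eq; rewrite free //; lia.
case: (ev c env) => [|bit v] /=.
  by rewrite same //; apply: cruns_le (costb _ _ _ _ _ B_ge env_B rep); lia.
have then_run : cruns (CSeq (clear d) (comp a rho d)) (upd (upd s d (bit :: v)) d v)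
    (upd s d (ev a env)) ((2 * (size v).+1).+1 + B ^ C).
  rewrite stE; apply: cruns_seq (cruns_le _ (cruns_clear _ _)) _.
    by rewrite upd_same; lia.
  by rewrite stE same //; apply: costa.
by case: bit then_run.
Qed.

Lemma small_expn env B C : 0 < C -> 2 <= B -> small env B -> small env (B ^ C).
Proof.
by move=> C_gt0 B_ge; apply: small_leq; rewrite -{1}(expn1 B) leq_expn.
Qed.

Lemma leq2_expn B C : 0 < C -> 2 <= B -> 2 <= B ^ C.
Proof. by move=> C_gt0 B_ge; rewrite (leq_trans B_ge) // -{1}(expn1 B) leq_expn. Qed.

Lemma cost_let x a b C : 0 < C -> comp_cost a C -> comp_cost b C ->
  size_poly a C -> size_poly b C -> comp_cost (ELet x a b) (9 + ((C + C * C) + (C + C * C))).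
Proof.
move=> C_gt0 costa costb size_a size_b rho d s env B B_ge env_B rep; have [var free] := rep.
have r1 := costa _ _ _ _ _ B_ge env_B rep.
have a_le := size_a _ _ B_ge env_B.
have X_gt0 : 0 < B ^ C by rewrite expn_gt0; lia.
have env1_B : small (upd env x (ev a env)) (B ^ C) by apply: small_upd; [apply: small_expn|].
have X_ge := leq2_expn C_gt0 B_ge.
have rep1 : represents (bind rho x d) d.+1 (upd env x (ev a env)) (upd s d (ev a env)).
  apply: represents_bind; rewrite ?upd_same //.
  by apply: represents_shift rep _ _ _ => // j le_j; lookup free.
have r2 := costb _ _ _ _ _ X_ge env1_B rep1.
have r3 := cruns_clear d (upd (upd s d (ev a env)) d.+1 (ev b (upd env x (ev a env)))).
have r4 := @cruns_move d.+1 d.+2 d _ ltac:(lia) ltac:(lia) ltac:(lia).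
apply: cruns_eq (cruns_seq r1 (cruns_seq r2 (cruns_seq r3 (r4 _ _)))) _ _; lookup free => //.
  by rewrite cats0; state_eq; rewrite free //; lia.
have b_le := size_b _ _ X_ge env1_B.
have Y_gt0 : 0 < B ^ (C * C) by rewrite expn_gt0; lia.
rewrite -expnM in b_le *; apply: absorb => //; rewrite expnD.
set X := B ^ C in a_le X_gt0 *; set Y := B ^ (C * C) in b_le Y_gt0 *.
have : X <= X * Y by nia.
have : Y <= X * Y by nia.
have : 1 <= X * Y by nia.
move: (X * Y) => Z *; nia.
Qed.

Lemma cost_for x n b C : 0 < C -> comp_cost n C -> comp_cost b C ->
  size_poly n C -> size_poly b C -> comp_cost (EFor x n b) (9 + ((C + C * C) + (C + C * C))).
Proof.
move=> C_gt0 costn costb size_n size_b rho d s env B B_ge env_B rep; have [var free] := rep.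
have r1 := costn _ _ _ _ _ B_ge env_B rep.
have n_le := size_n _ _ B_ge env_B.
have X_ge := leq2_expn C_gt0 B_ge.
pose st v a := upd (upd s d v) d.+1 a.
pose g v := ev b (upd env x v).
pose f (_ : bool) v a := g v ++ a.
have loopE v a : loop f v a = concat_loop g v ++ a.
  by elim: v a => //= bit v IH a; rewrite IH /f catA.
pose ok (v _ : seq bool) := is_true (size v <= size (ev n env)).
have small_v v : size v <= size (ev n env) -> small (upd env x v) (B ^ C).
  by move=> v_le; apply: small_upd; [apply: small_expn | apply: leq_trans v_le n_le].
have g_le v : size v <= size (ev n env) -> size (g v) <= B ^ (C * C).
  by move=> v_le; rewrite expnM; apply: size_b => //; apply: small_v.
set body := CSeq (comp b (bind rho x d) d.+2) (CSeq (transfer d.+2 d.+3) (transfer d.+3 d.+1)).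
have step (bit : bool) (v a : seq bool) : ok (bit :: v) a -> ok v (f bit v a) /\
    cruns (if bit then body else body) (upd (st (bit :: v) a) d v) (st v (f bit v a))
      (5 * B ^ (C * C)).+2.
  move=> /= ok_v; have v_le : size v <= size (ev n env) by apply: ltnW.
  split=> //; have -> : (if bit then body else body) = body by case: (bit).
  have -> : upd (st (bit :: v) a) d v = st v a by rewrite /st; state_eq.
  have rep1 : represents (bind rho x d) d.+2 (upd env x v) (st v a).
    apply: represents_bind => //; last by rewrite /st; lookup free.
    by apply: represents_shift rep _ _ _ => [|j le_j|j le_j]; rewrite ?/st; lookup free => //; lia.
  have r2 := costb _ _ _ _ _ X_ge (small_v _ v_le) rep1.
  have r3 := @cruns_move d.+2 d.+3 d.+1 _ ltac:(lia) ltac:(lia) ltac:(lia).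
  apply: cruns_eq (cruns_seq r2 (r3 _ _)) _ _; rewrite /st; lookup free => //.
    by rewrite /f /g; state_eq; rewrite free //; lia.
  by rewrite -expnM; have := g_le _ v_le; rewrite /g; lia.
have st_d v a : st v a d = v by rewrite /st; lookup free.
have r2 := cruns_while st_d step (leqnn (size (ev n env)) : ok (ev n env) [::]).
have r3 := @cruns_move d.+1 d.+2 d _ ltac:(lia) ltac:(lia) ltac:(lia).
have s_st : upd s d (ev n env) = st (ev n env) [::] by rewrite /st; state_eq; rewrite free //; lia.
rewrite -s_st loopE cats0 in r2.
apply: cruns_eq (cruns_seq r1 (cruns_seq r2 (r3 _ _))) _ _; rewrite /st; lookup free => //.
  by rewrite cats0 /=; state_eq; rewrite free //; lia.
have c_le : size (concat_loop g (ev n env)) <= size (ev n env) * B ^ (C * C).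
  by apply: size_concat_loop => w w_le; apply: g_le.
apply: absorb => //; rewrite expnD.
have X_gt0 : 0 < B ^ C by rewrite expn_gt0; lia.
have Y_gt0 : 0 < B ^ (C * C) by rewrite expn_gt0; lia.
move: (B ^ C) (B ^ (C * C)) (size (concat_loop _ _)) (size (ev n env)) X_gt0 Y_gt0 n_le c_le.
move=> X Y c_size n_size X_gt0 Y_gt0 n_le c_le.
have le1 : n_size * Y <= X * Y by nia.
have le2 : X <= X * Y by nia.
have le3 : n_size * (5 * Y).+3 <= 8 * (X * Y) by nia.
have le4 : 1 <= X * Y by nia.
move: (X * Y) (n_size * (5 * Y).+3) (n_size * Y) c_le le1 le2 le3 le4 => Z *; nia.
Qed.

(** The initial value and the cut keep the accumulator below [B ^ C], so every pass runs in an
    environment with this same bound and the cost of a pass does not depend on how many preceded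
    it. *)
Lemma cost_iter x y n i c b C : 0 < C ->
  comp_cost n C -> comp_cost i C -> comp_cost c C -> comp_cost b C ->
  size_poly n C -> size_poly i C -> size_poly c C -> size_poly b C ->
  comp_cost (EIter x y n i c b) (9 + ((C + C * C) + (C + C * C))).
Proof.
move=> C_gt0 costn costi costc costb size_n size_i size_c size_b.
move=> rho d s env B B_ge env_B rep; have [var free] := rep.
have r1 := costn _ _ _ _ _ B_ge env_B rep.
have rep1 : represents rho d.+1 env (upd s d (ev n env)).
  by apply: represents_shift rep _ _ _ => // j le_j; lookup free.
have r1' := costi _ _ _ _ _ B_ge env_B rep1.
have n_le := size_n _ _ B_ge env_B.
have i_le := size_i _ _ B_ge env_B.
have c_le := size_c _ _ B_ge env_B.
have X_ge := leq2_expn C_gt0 B_ge.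
pose st v a := upd (upd s d v) d.+1 a.
pose g v a := take (size (ev c env)) (ev b (upd (upd env x v) y a)).
pose f (_ : bool) v a := g v a.
have loopE v a : loop f v a = iter_loop g v a by elim: v a => //= bit v IH a; rewrite IH.
pose ok (v a : seq bool) := size v <= size (ev n env) /\ size a <= B ^ C.
have g_le v a : size (g v a) <= B ^ C.
  by rewrite /g size_take_min; apply: leq_trans (geq_minl _ _) c_le.
set body := CSeq (comp b (bind (bind rho x d) y d.+1) d.+2)
        (CSeq (clear d.+1) (CSeq (comp c rho d.+3)
        (CSeq (truncate d.+3 d.+2 d.+4) (CSeq (clear d.+2) (transfer d.+4 d.+1))))).
have step (bit : bool) (v a : seq bool) : ok (bit :: v) a -> ok v (f bit v a) /\
    cruns (if bit then body else body) (upd (st (bit :: v) a) d v) (st v (f bit v a))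
      (3 * B ^ (C * C) + 10 * B ^ C + 5).
  move=> [/= ok_v ok_a]; have v_le : size v <= size (ev n env) by apply: ltnW.
  split; first by split=> //; apply: g_le.
  have -> : (if bit then body else body) = body by case: (bit).
  have -> : upd (st (bit :: v) a) d v = st v a by rewrite /st; state_eq.
  have rep2 : represents rho d.+2 env (st v a).
    by apply: represents_shift rep _ _ _ => [|j le_j|j le_j]; rewrite ?/st; lookup free => //; lia.
  have rep3 : represents (bind (bind rho x d) y d.+1) d.+2 (upd (upd env x v) y a) (st v a).
    by apply: represents_bind; [apply: represents_bind => //| |]; rewrite ?/st; lookup free.
  have small_va : small (upd (upd env x v) y a) (B ^ C).
    apply: small_upd => //; apply: small_upd; first exact: small_expn.
    exact: leq_trans v_le n_le.
  have r2 := costb _ _ _ _ _ X_ge small_va rep3.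
  have r3 := cruns_clear d.+1 (upd (st v a) d.+2 (ev b (upd (upd env x v) y a))).
  set w := ev b _ in r2 r3.
  have rep4 : represents rho d.+3 env (upd (upd (st v a) d.+2 w) d.+1 [::]).
    by apply: represents_shift rep _ _ _ => [|j le_j|j le_j]; rewrite ?/st; lookup free => //; lia.
  have r4 := costc _ _ _ _ _ B_ge env_B rep4.
  have r5 := @cruns_truncate d.+3 d.+2 d.+4 _ ltac:(lia) ltac:(lia) ltac:(lia).
  have r6 := cruns_clear d.+2.
  have r7 := @cruns_transfer d.+4 d.+1 _ ltac:(lia).
  apply: cruns_eq (cruns_seq r2 (cruns_seq r3 (cruns_seq r4 (cruns_seq (r5 _ _)
    (cruns_seq (r6 _) (r7 _)))))) _ _; rewrite /st; lookup free => //.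
    by rewrite /f /g -/w revK cats0; state_eq; rewrite free //; lia.
  have w_le : size w <= B ^ (C * C) by rewrite expnM; apply: size_b.
  rewrite -expnM size_drop size_rev size_take_min.
  have := geq_minl (size (ev c env)) (size w).
  have := leq_subr (size (ev c env)) (size w).
  move: (minn _ _) (_ - _) => k1 k2; move: c_le w_le ok_a.
  move: (B ^ C) (B ^ (C * C)) => X Y; lia.
have st_d v a : st v a d = v by rewrite /st; lookup free.
have r2 := cruns_while st_d step (conj (leqnn _) i_le : ok (ev n env) (ev i env)).
have r3 := @cruns_move d.+1 d.+2 d _ ltac:(lia) ltac:(lia) ltac:(lia).
rewrite loopE in r2.
apply: cruns_eq (cruns_seq r1 (cruns_seq r1' (cruns_seq r2 (r3 _ _)))) _ _;
  rewrite /st; lookup free => //.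
  by rewrite cats0 /=; state_eq; rewrite free //; lia.
have l_le : size (iter_loop g (ev n env) (ev i env)) <= B ^ C by apply: size_iter_loop.
apply: absorb => //; rewrite expnD.
have X_gt0 : 0 < B ^ C by rewrite expn_gt0; lia.
have Y_gt0 : 0 < B ^ (C * C) by rewrite expn_gt0; lia.
have XY : B ^ C <= B ^ (C * C) by apply: leq_expn => //; nia.
move: (B ^ C) (B ^ (C * C)) (size (iter_loop _ _ _)) (size (ev n env)) X_gt0 Y_gt0 XY n_le l_le.
move=> X Y l_size n_size X_gt0 Y_gt0 XY n_le l_le.
have le1 : X <= X * Y by nia.
have le2 : n_size * (3 * Y + 10 * X + 5).+1 <= 19 * (X * Y) by nia.
have le3 : 1 <= X * Y by nia.
move: (X * Y) (n_size * _) l_le le1 le2 le3 => Z *; nia.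
Qed.

Lemma comp_poly e : exists C, comp_cost e C.
Proof.
have combine e1 e2 : (exists C, comp_cost e1 C) -> (exists C, comp_cost e2 C) ->
    exists C, [/\ 0 < C, comp_cost e1 C, size_poly e1 C, comp_cost e2 C & size_poly e2 C].
  move=> [C1 cost1] [C2 cost2]; have [C3 size1] := ev_size e1; have [C4 size2] := ev_size e2.
  exists (C1 + C2 + C3 + C4).+1; split=> //.
  - by apply: comp_cost_leq cost1; lia.
  - by apply: size_poly_leq size1; lia.
  - by apply: comp_cost_leq cost2; lia.
  - by apply: size_poly_leq size2; lia.
elim: e => [x||b e [C cost]|a IHa b IHb|n IHn a IHa|a IHa|c IHc a IHa b IHb|x a IHa b IHb
    |x n IHn b IHb|x y n IHn i IHi c IHc b IHb].
- exact: cost_var.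
- exists 0 => rho d s env B _ _ [_ free]; apply: cruns_eq (cruns_skip _) _ _ => //=.
  by state_eq; rewrite free //; lia.
- by exists C.+1; apply: cost_cons.
- by have [C [_ ? ? ? ?]] := combine _ _ IHa IHb; eexists; apply: cost_cat; eassumption.
- by have [C [_ ? ? ? ?]] := combine _ _ IHn IHa; eexists; apply: cost_drop; eassumption.
- by have [C [_ ? ? ? ?]] := combine _ _ IHa IHa; eexists; apply: cost_hd; eassumption.
- have [C [_ cc sc ca _]] := combine _ _ IHc IHa; have [D cb] := IHb.
  exists (9 + ((C + D) + (C + D))); apply: cost_if.
  + by apply: comp_cost_leq cc; lia.
  + by apply: comp_cost_leq ca; lia.
  + by apply: comp_cost_leq cb; lia.
  + by apply: size_poly_leq sc; lia.
- by have [C [? ? ? ? ?]] := combine _ _ IHa IHb; eexists; apply: cost_let; eassumption.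
- by have [C [? ? ? ? ?]] := combine _ _ IHn IHb; eexists; apply: cost_for; eassumption.
- have [C [C_gt0 cn sn ci si]] := combine _ _ IHn IHi.
  have [D [_ cc sc cb sb]] := combine _ _ IHc IHb.
  eexists; apply: (@cost_iter x y n i c b (C + D)); first by rewrite addn_gt0 C_gt0.
  + by apply: comp_cost_leq cn; lia.
  + by apply: comp_cost_leq ci; lia.
  + by apply: comp_cost_leq cc; lia.
  + by apply: comp_cost_leq cb; lia.
  + by apply: size_poly_leq sn; lia.
  + by apply: size_poly_leq si; lia.
  + by apply: size_poly_leq sc; lia.
  + by apply: size_poly_leq sb; lia.
Qed.

(** * Shortest witnesses and colourings *)

Section Closure.

Variables (N : nat) (E : nat -> nat -> bool).

Definition grow (X : nat -> bool) : nat -> bool :=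
  fun x => X x || has (fun y => X y && E y x) (iota 0 N).

Lemma grow_mono X n m x : n <= m -> iter n grow X x -> iter m grow X x.
Proof.
move=> /subnKC <-; elim: (m - n) => [|d IH] X_x; first by rewrite addn0.
by rewrite addnS iterS /grow IH.
Qed.

Lemma grow_step X n x y : y < N -> iter n grow X y -> E y x -> iter n.+1 grow X x.
Proof.
move=> y_lt X_y E_yx; rewrite iterS /grow; apply/orP; right.
by apply/hasP; exists y; rewrite ?mem_iota // X_y.
Qed.

(** The last clause matters for disjointness: whatever avoids the closure avoids every vertex of the
    path, not only its end. *)
Lemma grow_path X n x : iter n grow X x -> exists x0 p,
  [/\ X x0, path E x0 p, last x0 p = x & all (iter n grow X) (x0 :: p)].
Proof.
elim: n x => [|n IH] x; first by exists x, [::]; rewrite /= andbT.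
rewrite iterS {1}/grow; case: (boolP (iter n grow X x)) => [/IH + _|_].
  move=> [x0 [p [X_x0 Ep lastp /allP all_p]]]; exists x0, p; split=> //.
  by apply/allP => z z_in; apply: grow_mono (leqnSn n) (all_p z z_in).
rewrite orFb => /hasP[y y_in /andP[X_y E_yx]].
have [x0 [p [X_x0 Ep lastp /allP all_p]]] := IH _ X_y.
exists x0, (rcons p x); split=> //; first by rewrite rcons_path Ep lastp.
  by rewrite last_rcons.
rewrite -rcons_cons all_rcons; apply/andP; split.
  by apply: (grow_step (y := y)) => //; rewrite mem_iota in y_in.
by apply/allP => z z_in; apply: grow_mono (leqnSn n) (all_p z z_in).
Qed.

End Closure.

Section Paths.

Variables (Sigma : finType) (G : graph Sigma) (a : Sigma).

Definition adj (l : Sigma) (x y : nat) : bool := (x, l, y) \in G.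

Fixpoint lwalk (x : nat) (ls : seq Sigma) (p : seq nat) : bool :=
  match ls, p with
  | [::], [::] => true
  | l :: ls', y :: p' => adj l x y && lwalk y ls' p'
  | _, _ => false
  end.

Lemma lwalk_size x ls p : lwalk x ls p -> size ls = size p.
Proof. by elim: ls x p => [|l ls IH] x [|y p] //= /andP[_ /IH ->]. Qed.

Lemma lwalk_cat x ls1 ls2 p1 p2 : size ls1 = size p1 ->
  lwalk x (ls1 ++ ls2) (p1 ++ p2) = lwalk x ls1 p1 && lwalk (last x p1) ls2 p2.
Proof.
by elim: ls1 x p1 => [|l ls1 IH] x [|y p1] //= [sz]; rewrite IH // andbA.
Qed.

Lemma lwalk_nseq x p : lwalk x (nseq (size p) a) p = path (adj a) x p.
Proof. by elim: p x => //= y p IH x; rewrite IH. Qed.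

Lemma lwalk_nth x ls p i : lwalk x ls p -> i < size p ->
  adj (nth a ls i) (nth x (x :: p) i) (nth x (x :: p) i.+1).
Proof.
elim: ls x p i => [|l ls IH] x [|y p] [|i] //=; first by case/andP.
move=> /andP[_ walk] lt_i; have := IH _ _ _ walk lt_i.
by rewrite !(set_nth_default y x) //= ltnW.
Qed.

Lemma lwalkI x ls p : size ls = size p ->
  (forall i, i < size p -> adj (nth a ls i) (nth x (x :: p) i) (nth x (x :: p) i.+1)) ->
  lwalk x ls p.
Proof.
elim: ls x p => [|l ls IH] x [|y p] //= [sz] adj_p; apply/andP; split; first exact: (adj_p 0).
apply: IH => // i lt_i; have := adj_p i.+1 lt_i.
by rewrite !(set_nth_default y x) //= ltnW.
Qed.

Lemma simple_pathP s t ls :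
  (exists2 es, simple_path G s t es & path_label es = ls) <->
  (exists p, [/\ lwalk s ls p, last s p = t & uniq (s :: p)]).
Proof.
split=> [[es [walk [lst un]] <-]|[p [walk lst un]]].
  exists (map (@e_tgt Sigma) es); split=> //; move: walk {lst un}.
  elim: es s => //= [[[x l] y] es] IH s; rewrite /e_src /e_tgt /e_lab /=.
  by move=> /andP[/andP[in_G /eqP <-] /IH]; rewrite /adj in_G.
have [es [walk_es tgt_es lab_es]] : exists es,
    [/\ is_walk G s es, map (@e_tgt Sigma) es = p & path_label es = ls].
  elim: ls s p walk {lst un} => [|l ls IH] s [|y p] //=; first by exists [::].
  move=> /andP[in_G /IH[es [walk_es tgt_es lab_es]]]; exists ((s, l, y) :: es).
  by rewrite /= /e_src /e_tgt /e_lab /= eqxx -/(adj l s y) in_G walk_es tgt_es lab_es.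
by exists es => //; split=> //; rewrite /walk_nodes tgt_es.
Qed.

End Paths.

(** * The criterion for a guessed word path and colouring *)

Section Criterion.

Variables (Sigma : finType) (G : graph Sigma) (a : Sigma) (s t k N : nat).
Variables (u : seq Sigma) (v : nat -> nat) (col : nat -> nat).

Definition on_word (x : nat) := has (fun j => x == v j) (iota 0 (size u).+1).

Definition word_walk :=
  all (fun j => adj G (nth a u j) (v j) (v j.+1)) (iota 0 (size u)) &&
  all (fun j => all (fun i => v i != v j) (iota 0 j)) (iota 0 (size u).+1).

(** The prefix ends in [v 0], the only vertex that it may share with the word path. *)
Definition allowed (x : nat) := ~~ on_word x || (x == v 0).

Definition prefix_start (x : nat) := [&& x == s, col x == 0 & allowed x].
Definition prefix_edge (y x : nat) :=
  [&& adj G a y x, col x == (col y).+1, col x <= k & allowed x].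
Definition prefix_set := iter N (grow N prefix_edge) prefix_start.

Definition suffix_start (x : nat) := x == v (size u).
(** Only heads of edges are tested, so the start [v (size u)] is exempt; for empty [u] it is [v 0],
    which the prefix does reach. *)
Definition suffix_edge (y x : nat) := [&& adj G a y x, ~~ prefix_set x & ~~ on_word x].
Definition suffix_set := iter N (grow N suffix_edge) suffix_start.

(* A choice of a [u]-labelled path [v 0, ..., v (size u)] and a colouring [col]
   accepts if [v 0] is reached from [s] by [a]-edges along the colours
   [0, ..., k], and [t] from [v (size u)] by [a]-edges avoiding all vertices
   that can be so reached. *)
Definition accepts := [&& word_walk, prefix_set (v 0), col (v 0) == k & suffix_set t].

Lemma word_uniq : word_walk -> uniq (map v (iota 0 (size u).+1)).
Proof.
case/andP=> _ /allP distinct; rewrite map_inj_in_uniq ?iota_uniq //.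
move=> i j i_in j_in E; apply/eqP; move: i_in j_in.
wlog lt_ij : i j E / i <= j => [wl|].
  by case/orP: (leq_total i j) => h *; [apply: wl | rewrite eq_sym; apply: wl].
move=> _ /distinct/allP/(_ i); rewrite mem_iota /= E eqxx.
by case: ltngtP lt_ij => // _ _ /(_ isT).
Qed.

Lemma on_wordP x : reflect (x \in map v (iota 0 (size u).+1)) (on_word x).
Proof.
apply: (iffP hasP) => [[j j_in /eqP ->]|/mapP[j j_in ->]]; first exact: map_f.
by exists j.
Qed.

Lemma prefix_path_col x p : path prefix_edge x p -> map col (x :: p) = iota (col x) (size p).+1.
Proof.
by elim: p x => //= y p IH x /andP[/and4P[_ /eqP E _ _] /IH /= ->]; rewrite E.
Qed.

Lemma prefix_path_uniq x p : path prefix_edge x p -> uniq (x :: p).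
Proof. by move=> /prefix_path_col E; apply: (@map_uniq _ _ col); rewrite E iota_uniq. Qed.

Lemma prefix_path_size x p : col x = 0 -> path prefix_edge x p -> size p = col (last x p).
Proof.
move=> x0 /prefix_path_col E; have := congr1 (nth 0 ^~ (size p)) E.
rewrite x0 nth_iota // add0n (nth_map x) //= => <-.
by rewrite -[RHS]/(col _) (last_nth x).
Qed.

Lemma prefix_setP x : prefix_set x -> exists p,
  [/\ col s = 0, path prefix_edge s p, last s p = x & all prefix_set (s :: p)].
Proof.
by move=> /grow_path[x0 [p [/and3P[/eqP -> /eqP col0 _] path_p lastp all_p]]]; exists p.
Qed.

(** The colours of the prefix are [0, ..., k], which gives both simplicity and the length [k]. Its
    vertices all lie in the prefix set, hence off the suffix, and [allowed] keeps them off the word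
    path except for the junction. *)
Lemma accepts_sound : accepts -> exists m p,
  [/\ lwalk G s (nseq k a ++ u ++ nseq m a) p, last s p = t & uniq (s :: p)].
Proof.
case/and4P=> word_ok /prefix_setP[p1 [col_s path1 last1 in1]] /eqP col_v0 suffix_t.
have uniq_w := word_uniq word_ok.
have [x0 [p3' [/eqP -> path3' last3' _]]] := grow_path suffix_t.
(* Cutting loops out of the suffix only lowers the exponent [m], which is free. *)
move: (path3') last3'; case/shortenP => p3 path3 uniq3 _ last3 {p3' path3'}.
have size1 : size p1 = k by rewrite (prefix_path_size col_s path1) last1.
have allowed1 : all allowed (s :: p1).
  rewrite /= andbC; apply/andP; split.
    by elim: (p1) (s) path1 {last1 in1 uniq_w} => //= y p IH x /andP[/and4P[_ _ _ ->] /IH].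
  have : prefix_set s by apply: (allP in1); apply: mem_head.
  case/grow_path => y [q [/and3P[/eqP -> _ ok_s] _ _ _]].
  exact: ok_s.
pose p2 := map v (iota 1 (size u)).
have last2 : last (v 0) p2 = v (size u).
  by rewrite /p2 last_map (last_nth 0) size_iota -[0 :: _]/(iota 0 (size u).+1) nth_iota.
exists (size p3), (p1 ++ p2 ++ p3); split.
- rewrite lwalk_cat ?size_nseq ?size1 // lwalk_cat ?size_map ?size_iota //.
  rewrite last1 last2 -{1}size1 !lwalk_nseq; apply/and3P; split.
  + by apply: sub_path path1 => x y /and4P[].
  + apply: lwalkI; rewrite ?size_map ?size_iota // => i lt_i.
    have [/allP walk_w _] := andP word_ok.
    have E j : j <= size u -> nth (v 0) (v 0 :: p2) j = v j.
      case: j => //= j lt_j; rewrite (nth_map 0) ?size_iota // nth_iota //.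
    by rewrite !E // 1?ltnW //; apply: walk_w; rewrite mem_iota.
  + by apply: sub_path path3 => x y /and3P[].
- by rewrite !last_cat last1 last2.
rewrite -cat_cons catA cat_uniq [uniq (_ ++ p2)]cat_uniq.
have uniq2 : uniq p2 by move: uniq_w => /= /andP[].
have p3_out x : x \in p3 -> ~~ prefix_set x /\ ~~ on_word x.
  elim: (p3) (v _) path3 => //= z p IH y /andP[/and3P[_ U_z W_z] path_p].
  by rewrite inE => /orP[/eqP ->|/(IH _ path_p)].
have uniq_p3 : uniq p3 by case/andP: uniq3.
rewrite (prefix_path_uniq path1) uniq2 uniq_p3 andbT /= andbT.
apply/andP; split; apply/hasPn => x.
- move=> x_in2; apply/negP => /(allP allowed1); rewrite /allowed.
  have -> : on_word x by apply/on_wordP; rewrite /= inE -/p2 x_in2 orbT.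
  by move=> /= /eqP E; move: uniq_w; rewrite /= -E -/p2 x_in2.
- move=> /p3_out[U_x W_x]; rewrite -cat_cons mem_cat negb_or; apply/andP; split.
    by apply: contra U_x => /(allP in1).
  by apply: contra W_x => x_in2; apply/on_wordP; rewrite /= inE -/p2 x_in2 orbT.
Qed.

(** Minimality is required only against powers of [a], since the shortcut of the argument skips the
    word. The condition [size p < k + j] singles out the last [k] positions of the path. *)
Lemma accepts_complete m p :
  (forall x y l, adj G l x y -> y < N) -> s < N ->
  lwalk G s (nseq k a ++ u ++ nseq m a) p -> last s p = t -> uniq (s :: p) ->
  (forall m' p', lwalk G s (nseq (k + m') a) p' -> last s p' = t -> uniq (s :: p') ->
     size p <= size p') ->
  (forall j, j <= size u -> v j = nth s (s :: p) (k + j)) ->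
  (forall j, j <= k -> col (nth s (s :: p) j) = j) ->
  (forall j, k + size u < j <= size p -> size p < k + j -> col (nth s (s :: p) j) = k.+1) ->
  accepts.
Proof.
move=> tgt_lt s_lt walk lastp uniq_p minimal vE col_prefix col_suffix.
set c := size u in vE col_suffix; set P := nth s (s :: p) in vE col_prefix col_suffix.
have P0 : P 0 = s by [].
have size_p : size p = k + c + m by rewrite -(lwalk_size walk) !size_cat !size_nseq addnA.
have P_adj i : i < size p -> adj G (nth a (nseq k a ++ u ++ nseq m a) i) (P i) (P i.+1).
  exact: lwalk_nth walk.
have P_lt i : i <= size p -> P i < N.
  by case: i => // i lt_i; apply: tgt_lt (P_adj _ lt_i).
have P_eq i j : i <= size p -> j <= size p -> (P i == P j) = (i == j).
  by move=> le_i le_j; apply: nth_uniq.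
(* A simple path has fewer than [N] edges, so [N] rounds of [grow] reach its end. *)
have size_lt : size p < N.
  rewrite -(size_iota 0 N); apply: (uniq_leq_size uniq_p) => x /(nthP s)[i lt_i <-].
  by rewrite mem_iota /= P_lt.
have P_adj_a i : i < size p -> i < k \/ k + c <= i -> adj G a (P i) (P i.+1).
  move=> lt_i side; have := P_adj i lt_i; rewrite nth_cat size_nseq.
  case: ltnP => [lt_k|ge_k]; first by rewrite nth_nseq lt_k.
  rewrite nth_cat ifF; last by rewrite -/c; lia.
  by rewrite nth_nseq ifT //; rewrite -/c; lia.
have on_wordE i : i <= size p -> on_word (P i) = (k <= i <= k + c).
  move=> le_i; apply/idP/idP => [/on_wordP/mapP[j]|/andP[ge_i le_i']].
    rewrite mem_iota -/c => lt_j /eqP; rewrite vE ?P_eq; try lia.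
  apply/on_wordP/mapP; exists (i - k); first by rewrite mem_iota -/c; lia.
  by rewrite vE; [congr P; lia | lia].
have v0E : v 0 = P k by rewrite vE // addn0.
have allowedE i : i <= k -> allowed (P i).
  move=> le_i; rewrite /allowed on_wordE ?v0E ?P_eq; try lia.
have in_prefix j : j <= k -> prefix_set (P j).
  move=> le_j; apply: (@grow_mono _ _ _ j); first lia.
  elim: j le_j => [|j IH] le_j.
    by rewrite /= /prefix_start col_prefix // allowedE // P0 !eqxx.
  apply: grow_step (IH (ltnW le_j)) _; first by apply: P_lt; lia.
  rewrite /prefix_edge P_adj_a ?col_prefix ?allowedE //; try lia.
have out_prefix j : k + c < j -> j <= size p -> ~~ prefix_set (P j).
  move=> gt_j le_j; apply/negP => /prefix_setP[q [col_s path_q last_q _]].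
  pose later x := has (fun i => x == P i) (iota (k + c).+1 m).
  have laterP i : i <= size p -> later (P i) = (k + c < i).
    move=> le_i; apply/hasP/idP => [[i']|gt_i].
      by rewrite mem_iota => i'_in; rewrite P_eq => [/eqP ->||]; lia.
    by exists i; rewrite ?mem_iota ?eqxx //; lia.
  have has_later : has later (s :: q).
    apply/hasP; exists (P j); first by rewrite -last_q mem_last.
    by rewrite laterP.
  pose i0 := find later (s :: q).
  have i0_lt : i0 < (size q).+1 by have := has_later; rewrite has_find.
  have [j' /andP[gt_j' le_j'] Ej'] : exists2 j', k + c < j' <= size p & nth s (s :: q) i0 = P j'.
    have /hasP[j' j'_in /eqP Ej'] := nth_find s has_later.
    by exists j'; rewrite mem_iota in j'_in => //; lia.
  have i0_gt : 0 < i0.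
    rewrite lt0n; apply/eqP => E0; have /eqP : P 0 = P j' by rewrite P0 -Ej' E0.
    by rewrite P_eq; lia.
  pose q' := take i0 q.
  have size_q' : size q' = i0 by rewrite size_takel.
  have path_q' : path prefix_edge s q'.
    by move: path_q; rewrite -{1}(cat_take_drop i0 q) cat_path => /andP[].
  have last_q' : last s q' = P j'.
    by rewrite -Ej' (last_nth s) size_q' /q' -[s :: take i0 q]/(take i0.+1 (s :: q)) nth_take.
  have col_j' : col (P j') = i0 by rewrite -last_q' -prefix_path_size.
  (* The vertex is entered by a prefix edge, as [i0] is positive, and such edges only lead to
     colours up to [k]. *)
  have i0_le : i0 <= k.
    rewrite -col_j' -last_q'; move: path_q' size_q' i0_gt.
    case/lastP: (q') => [_ <- //|r x]; rewrite rcons_path last_rcons => /andP[_].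
    by case/and4P.
  (* Otherwise [P j'] would be among the last [k] vertices and have colour [k + 1]. *)
  have far : k + j' <= size p.
    rewrite leqNgt; apply/negP => near; have := col_suffix j'.
    by rewrite gt_j' le_j' col_j' => /(_ isT near); lia.
  pose p' := q' ++ drop j' p.
  have drop_nth i : nth s (drop j' p) i = P (j' + i).+1 by rewrite nth_drop.
  have size_d : size (drop j' p) = size p - j' by rewrite size_drop.
  have size_p' : size p' = i0 + (size p - j') by rewrite size_cat size_q' size_d.
  (* This is absurd, because [i0 <= k < j']. *)
  suff : size p <= size p' by rewrite size_p'; lia.
  (* The truncated subtraction of [k] is exact by [far]: at least [k] edges remain after [P j']. *)
  apply: (minimal (i0 + (size p - j') - k)).
  - have -> : k + (i0 + (size p - j') - k) = i0 + (size p - j') by lia.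
    rewrite nseqD lwalk_cat ?size_nseq // -{1}size_q' lwalk_nseq.
    apply/andP; split; first by apply: sub_path path_q' => x y /and4P[].
    rewrite last_q'; apply: (lwalkI (a := a)); rewrite ?size_nseq ?size_d // => i lt_i.
    have nthE i' : i' <= size p - j' -> nth (P j') (P j' :: drop j' p) i' = P (j' + i').
      case: i' => [|i'] le_i'; first by rewrite addn0.
      by rewrite /= (set_nth_default s) ?size_d // drop_nth addnS.
    rewrite nth_nseq lt_i !nthE ?(ltnW lt_i) // addnS; apply: P_adj_a; lia.
  - rewrite last_cat last_q' -lastp.
    have -> : last s p = P (size p) by rewrite (last_nth s).
    rewrite (last_nth s) size_d; case E: (size p - j') => [|d]; first by congr P; lia.
    by rewrite /= drop_nth; congr P; lia.
  rewrite -cat_cons cat_uniq (prefix_path_uniq path_q') drop_uniq; last by case/andP: uniq_p.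
  rewrite andbT; apply/hasPn => x /(nthP s)[i]; rewrite size_d drop_nth => lt_i <-.
  apply/negP => /(nthP s)[i1]; rewrite /= size_q' => i1_le Ei1.
  (* A common vertex before position [i0] contradicts the choice of [i0] as the first hit; at [i0]
     it would be [P j'], but the tail kept starts after [j']. *)
  have : later (nth s (s :: q') i1) by rewrite Ei1 laterP; lia.
  have [lt_i1|ge_i1] := ltnP i1 i0.
    have := before_find s (lt_i1 : i1 < find later (s :: q)).
    by rewrite -[s :: q']/(take i0.+1 (s :: q)) nth_take // => ->.
  have E : i1 = size q' by lia.
  move: Ei1; rewrite E -last_nth last_q' => /eqP; rewrite P_eq; lia.
have vcE : v c = P (k + c) by rewrite vE.
apply/and4P; split.
- apply/andP; split; apply/allP => j; rewrite mem_iota -/c => lt_j.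
    rewrite !vE; try lia; rewrite addnS.
    have -> : nth a u j = nth a (nseq k a ++ u ++ nseq m a) (k + j).
      by rewrite nth_cat size_nseq ltnNge leq_addr /= addKn nth_cat ifT.
    by apply: P_adj; lia.
  apply/allP => i; rewrite mem_iota => lt_i.
  by rewrite !vE; try lia; rewrite P_eq; lia.
- by rewrite v0E in_prefix.
- by rewrite v0E col_prefix.
have in_suffix i : i <= m -> iter i (grow N suffix_edge) suffix_start (P (k + c + i)).
  elim: i => [|i IH] le_i; first by rewrite /= /suffix_start -/c vcE addn0.
  apply: grow_step (IH (ltnW le_i)) _; first by apply: P_lt; lia.
  rewrite /suffix_edge addnS P_adj_a; try lia.
  rewrite out_prefix ?on_wordE; lia.
apply: (@grow_mono _ _ _ m); first lia.
by have := in_suffix m (leqnn _); rewrite -size_p /P -last_nth lastp.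
Qed.

End Criterion.

(* The bits of [x] at the positions where [m] has a one, packed together. *)
Fixpoint compress (f m x : nat) : nat :=
  if f is f'.+1 then
    let r := compress f' m./2 x./2 in if odd m then odd x + 2 * r else r
  else 0.

Lemma compress0 f x : compress f 0 x = 0.
Proof. by elim: f x => //= f IH x; rewrite IH. Qed.

Lemma uniq_map_inj (T1 T2 : eqType) (f : T1 -> T2) (r : seq T1) :
  uniq (map f r) -> {in r &, injective f}.
Proof.
elim: r => //= z r IH /andP[z_notin uniq_r] x y; rewrite !inE.
move=> /orP[/eqP ->|x_in] /orP[/eqP ->|y_in] E //; last exact: IH.
  by rewrite E map_f in z_notin.
by rewrite -E map_f in z_notin.
Qed.

(* Either halving merges two elements of [S], and the lowest bit is kept, or it
   is injective on [S], and the lowest bit is dropped. *)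
Lemma compress_inj L f (S : seq nat) : L <= f -> uniq S -> S != [::] ->
  {in S, forall x, x < 2 ^ L} ->
  exists m, [/\ m < 2 ^ L, {in S &, injective (compress f m)} &
    {in S, forall x, compress f m x < 2 ^ (size S).-1}].
Proof.
elim: L f S => [|L IH] f S le_f uniq_S S_n0 S_lt.
  exists 0; split=> // [x y /S_lt + /S_lt|x _]; last by rewrite compress0 expn_gt0.
  by case: x y => [|x] [|y].
case: f le_f => // f le_f; pose S' := undup (map half S).
have half_lt x : x \in S -> x./2 < 2 ^ L by move=> /S_lt; rewrite expnS; lia.
have le_S' : size S' <= size S by rewrite -(size_map half S) size_undup.
have mem_S' x : x \in S -> x./2 \in S' by move=> x_in; rewrite mem_undup map_f.
have S'_n0 : S' != [::].
  have [x x_in] : exists x, x \in S by case: (S) S_n0 => // x S0; exists x; apply: mem_head.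
  by have := mem_S' _ x_in; case: (S').
have [|m' [m'_lt inj_m' m'_bound]] := IH f S' le_f (undup_uniq _) S'_n0.
  by move=> y; rewrite mem_undup => /mapP[x x_in ->]; apply: half_lt.
have lt_S' : 0 < size S' by case: (S') S'_n0.
case: (ltnP (size S') (size S)) => [lt_S|ge_S].
  exists (m'.*2.+1); rewrite /= odd_double /= uphalf_double.
  split=> [|x y x_in y_in E|x x_in]; first by rewrite expnS; lia.
    have odd_xy : odd x = odd y by move: (congr1 odd E); rewrite !mul2n !oddD !odd_double !addbF !oddb.
    have /inj_m' half_xy : compress f m' x./2 = compress f m' y./2.
      by move: E; rewrite odd_xy; lia.
    by rewrite -(odd_double_half x) -(odd_double_half y) odd_xy half_xy ?mem_S'.
  have := m'_bound _ (mem_S' _ x_in).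
  (* The bit that is kept doubles the bound; the merging of two elements pays for it. *)
  have : 2 ^ (size S').-1.+1 <= 2 ^ (size S).-1 by rewrite leq_exp2l //; lia.
  rewrite expnS; move: (2 ^ (size S').-1) (2 ^ (size S).-1) (compress _ _ _) => A B r.
  by case: (odd x) => /=; lia.
have inj_half : {in S &, injective half}.
  by apply: uniq_map_inj; rewrite -[uniq _]negbK -ltn_size_undup size_map -leqNgt.
exists (m'.*2); rewrite /= odd_double /= doubleK.
split=> [|x y x_in y_in E|x x_in]; first by rewrite expnS; lia.
  by apply: inj_half => //; apply: inj_m' E; apply: mem_S'.
have -> : size S = size S' by lia.
exact: m'_bound (mem_S' _ x_in).
Qed.

(** Turns the choice of a tuple into the choice of one number, hence into a loop counter. It serves
    for the colour table in base [k + 2] and for the vertices of the word path in base [N]. *)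
Lemma digits b M (d : nat -> nat) : (forall j, j < M -> d j < b) ->
  exists2 n, n < b ^ M & forall j, j < M -> iter j (divn^~ b) n %% b = d j.
Proof.
elim: M d => [|M IH] d d_lt; first by exists 0.
have [|n n_lt nE] := IH (fun j => d j.+1); first by move=> j lt_j; apply: (d_lt j.+1).
have b_gt0 : 0 < b by apply: leq_ltn_trans (d_lt 0 _).
exists (n * b + d 0); first by rewrite expnS; have := d_lt 0 isT; nia.
case=> [|j] lt_j; first by rewrite /= modnMDl modn_small ?d_lt.
by rewrite iterSr divnMDl // divn_small ?d_lt // addn0 nE.
Qed.

(** The form of [compress] that an [EIter] computes: from the highest position down, with the
    accumulator cut at [cap]. *)
Fixpoint capped_compress (cap m x n acc : nat) : nat :=
  if n is n'.+1 then
    capped_compress cap m x n'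
      (minn cap (if odd (iter n' half m) then odd (iter n' half x) + 2 * acc else acc))
  else acc.

Lemma compress_mono f j m x :
  compress f (iter j half m) (iter j half x) <= compress (f + j) m x.
Proof.
elim: j m x => [|j IH] m x; first by rewrite addn0.
rewrite !iterSr addnS; apply: leq_trans (IH _ _) _ => /=.
by case: (odd m); lia.
Qed.

(** Partial results never exceed the final one, so a cap respected by the final value never takes
    effect. *)
Lemma capped_compressE cap m x f j : compress (f + j) m x <= cap ->
  capped_compress cap m x j (compress f (iter j half m) (iter j half x)) = compress (f + j) m x.
Proof.
elim: j f => [|j IH] f le_cap; first by rewrite addn0.
rewrite -addSnnS; rewrite -addSnnS in le_cap; rewrite -IH //=.
congr (capped_compress _ _ _ _ _).
by apply/minn_idPr; apply: leq_trans le_cap; apply: (compress_mono f.+1 j).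
Qed.

Definition colour (N k cap m n : nat) (x : nat) : nat :=
  iter (capped_compress cap m x N 0) (divn^~ k.+2) n %% k.+2.

Lemma colour_exists N k cap (S : seq nat) (target : nat -> nat) :
  uniq S -> S != [::] -> size S <= (2 * k).+1 -> {in S, forall x, x < N} ->
  (forall x, target x < k.+2) -> 2 ^ (2 * k) <= cap ->
  exists m n, [/\ m < N + N, n < k.+2 ^ 2 ^ (2 * k) &
    {in S, forall x, colour N k cap m n x = target x}].
Proof.
move=> uniq_S S_n0 size_S S_lt target_lt cap_ge.
have N_gt0 : 0 < N by case: (S) S_n0 S_lt => // x S' _ /(_ x (mem_head _ _)); case: (N).
(* [L] bits hold every vertex, and [2 ^ L] is at most [2 N], whence the bound on the mask; [N] is at
   least [L] and serves as the number of positions scanned. *)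
pose L := (trunc_log 2 N).+1; have N_lt : N < 2 ^ L by apply: trunc_log_ltn.
have L_le : 2 ^ L.-1 <= N by apply: trunc_logP.
have [|x x_in|m [m_lt inj_m m_bound]] := @compress_inj L N S _ uniq_S S_n0.
- by apply: leq_trans L_le; apply: ltn_expl.
- by apply: ltn_trans (S_lt _ x_in) N_lt.
have bound x : x \in S -> compress N m x < 2 ^ (2 * k).
  by move=> /m_bound/leq_trans; apply; rewrite leq_exp2l //; lia.
(* The table entry at [i] is the target colour of the element with packed bits [i]; indices that no
   element has get the default 0. *)
pose d i := nth 0 (map target S) (index i (map (compress N m) S)).
have [|n n_lt nE] := @digits k.+2 (2 ^ (2 * k)) d.
  move=> i _; rewrite /d; case: (ltnP (index i (map (compress N m) S)) (size S)) => lt_i.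
    by rewrite (nth_map 0).
  by rewrite nth_default ?size_map.
exists m, n; split=> // [|x x_in].
  by apply: leq_trans m_lt _; move: L_le; rewrite /L expnS /=; lia.
have -> : colour N k cap m n x = iter (compress N m x) (divn^~ k.+2) n %% k.+2.
  have E := @capped_compressE cap m x 0 N; rewrite add0n [compress 0 _ _]/= in E.
  by rewrite /colour E //; apply: leq_trans cap_ge; apply: ltnW (bound _ x_in).
rewrite nE ?bound // /d.
have -> : index (compress N m x) (map (compress N m) S) = index x S.
  have -> : compress N m x = nth 0 (map (compress N m) S) (index x S).
    by rewrite (nth_map 0) ?nth_index ?index_mem.
  by apply: index_uniq; rewrite ?size_map ?index_mem // map_inj_in_uniq.
by rewrite (nth_map 0) ?index_mem // nth_index.
Qed.

(** * Exhaustive search over the guesses *)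

Section Search.

Variables (Sigma : finType) (a : Sigma) (w : seq Sigma) (I : instance Sigma) (N g : nat).

Let G := i_graph I.
Let s := i_s I.
Let t := i_t I.
Let k := i_k I.

Definition digit (n j : nat) := iter j (divn^~ N) n %% N.

(** [g] plays two roles: it bounds the number of colour tables and caps the packed index. *)
Definition search (u : seq Sigma) := exists n m c,
  [/\ n < N ^ (size u).+1, m < N + N, c < g &
      accepts G a s t k N u (digit n) (colour N k g m c)].

Lemma search_sound u : u = [::] \/ u = w -> search u -> yes_instance a w I.
Proof.
move=> u_word [n [m [c [_ _ _ /accepts_sound[r [p path_p]]]]]].
have [es path_es lab_es] := (simple_pathP G s t _).2 (ex_intro _ p path_p).
exists es; split=> //; exists r; rewrite lab_es.
by case: u_word => ->; [left | right].
Qed.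

Hypothesis s_lt : s < N.
Hypothesis tgt_lt : forall x y l, adj G l x y -> y < N.
Hypothesis g_table : k.+2 ^ 2 ^ (2 * k) <= g.
Hypothesis g_cap : 2 ^ (2 * k) <= g.

Lemma search_minimal u m p :
  lwalk G s (nseq k a ++ u ++ nseq m a) p -> last s p = t -> uniq (s :: p) ->
  (forall m' p', lwalk G s (nseq (k + m') a) p' -> last s p' = t -> uniq (s :: p') ->
     size p <= size p') ->
  search u.
Proof.
move=> walk lastp uniq_p minimal.
have size_p : size p = k + size u + m by rewrite -(lwalk_size walk) !size_cat !size_nseq addnA.
set P := nth s (s :: p).
have P_lt i : i <= size p -> P i < N.
  case: i => // i lt_i; have := lwalk_nth a walk lt_i; exact: tgt_lt.
have P_index i : i <= size p -> index (P i) (s :: p) = i.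
  by move=> le_i; apply: index_uniq.
have [|n n_lt nE] := @digits N (size u).+1 (fun j => P (k + j)).
  by move=> j lt_j; apply: P_lt; lia.
(* One formula serves both ends of the path, even where the ranges in [ix] overlap: positions up to
   [k] are their own colour, and all later ones are cut to [k + 1]. *)
pose target x := minn (index x (s :: p)) k.+1.
pose ix := iota 0 k.+1 ++ iota ((size p).+1 - k) k.
have ix_le i : i \in ix -> i <= size p.
  by rewrite mem_cat !mem_iota; lia.
pose S := undup (map P ix).
have [||||m' [c [m'_lt c_lt cE]]] := @colour_exists N k g S target (undup_uniq _) _ _ _ _ g_cap.
- have : P 0 \in S by rewrite mem_undup map_f // mem_cat mem_iota.
  by case: S.
- by apply: leq_trans (size_undup _) _; rewrite size_map size_cat !size_iota; lia.
- by move=> x; rewrite mem_undup => /mapP[i /ix_le le_i ->]; apply: P_lt.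
- by move=> x; rewrite ltnS geq_minr.
have colE i : i \in ix -> colour N k g m' c (P i) = minn i k.+1.
  move=> i_in; rewrite cE; last by rewrite mem_undup map_f.
  by rewrite /target P_index ?ix_le.
exists n, m', c; split=> //; first exact: leq_trans g_table.
apply: (accepts_complete (p := p) (m := m)) => // j.
- move=> le_j; rewrite colE; first by apply/minn_idPl; exact: leqW.
  by rewrite mem_cat mem_iota; lia.
- move=> j_in near; rewrite colE; first by apply/minn_idPr; lia.
  by rewrite mem_cat !mem_iota; lia.
Qed.

(** Descent on the length: a shorter simple path labelled by at least [k] letters [a] is a witness
    with empty [u], to which the induction applies; if there is none, the current witness has the
    minimality required. *)
Lemma search_complete : yes_instance a w I -> search [::] \/ search w.
Proof.
case=> es [path_es [m lab]].
have {lab} [u [u_word lab]] : exists u, (u = [::] \/ u = w) /\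
    path_label es = nseq k a ++ u ++ nseq m a.
  by case: lab => lab; [exists [::] | exists w]; split; auto.
have [p] := (simple_pathP G s t _).1 (ex_intro2 _ _ es path_es lab).
have [b] := ubnP (size p); elim: b => // b IH in u u_word m p {es path_es lab} *.
move=> lt_p [walk lastp uniq_p].
have [[m' [p' [walk' lastp' uniq_p' lt_p']]]|minimal] := Classical_Prop.classic
  (exists m' p', [/\ lwalk G s (nseq (k + m') a) p', last s p' = t, uniq (s :: p') &
     size p' < size p]).
  apply: (IH [::] _ m' p'); [by left | exact: leq_trans lt_p' _ | split=> //].
  by rewrite -nseqD.
have : search u.
  apply: (search_minimal walk) => // m' p' walk' lastp' uniq_p'; rewrite leqNgt.
  by apply/negP => lt_p'; apply: minimal; exists m', p'.
by case: u_word => ->; [left | right].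
Qed.

End Search.

(** * The decision procedure as an expression *)

Definition num e env := size (ev e env).
Definition holds e env := 0 < num e env.

Lemma size_concat_loop_sum f v F : (forall w, size w < size v -> size (f w) = F (size w)) ->
  size (concat_loop f v) = \sum_(i < size v) F i.
Proof.
elim: v => [|b v IH] fF /=; first by rewrite big_ord0.
rewrite size_cat big_ord_recr /= fF // IH // => w w_lt.
by apply: fF; apply: leqW.
Qed.

Lemma num_for x n b env F :
  (forall w, size w < num n env -> num b (upd env x w) = F (size w)) ->
  num (EFor x n b) env = \sum_(i < num n env) F i.
Proof. exact: size_concat_loop_sum. Qed.

Lemma holds_for x n b env (F : nat -> bool) :
  (forall w, size w < num n env -> holds b (upd env x w) = F (size w)) ->
  holds (EFor x n b) env = has F (iota 0 (num n env)).
Proof.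
rewrite /holds /num /=; elim: (ev n env) => [|bit v IH] // bF.
rewrite [size (_ :: v)]/= -(addn1 (size v)) iotaD has_cat /= orbF add0n.
rewrite size_cat addn_gt0 bF //= IH // => w w_lt.
by apply: bF; apply: leqW.
Qed.

Lemma num_iter x y n i c b env (F : nat -> nat -> nat) :
  (forall w acc, minn (num c env) (num b (upd (upd env x w) y acc)) = F (size w) (size acc)) ->
  num (EIter x y n i c b) env =
  (fix loop k acc := if k is k'.+1 then loop k' (F k' acc) else acc) (num n env) (num i env).
Proof.
rewrite /num /= => bF; elim: (ev n env) (ev i env) => [|bit v IH] acc //=.
by rewrite IH size_take_min bF.
Qed.

Lemma num_let x a b env : num (ELet x a b) env = num b (upd env x (ev a env)).
Proof. by []. Qed.

Lemma num_var x env : num (EVar x) env = size (env x).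
Proof. by []. Qed.

Lemma num_cons b e env : num (ECons b e) env = (num e env).+1.
Proof. by []. Qed.

Lemma num_cat a b env : num (ECat a b) env = num a env + num b env.
Proof. exact: size_cat. Qed.

Lemma num_drop n a env : num (EDrop n a) env = num a env - num n env.
Proof. exact: size_drop. Qed.

Fixpoint eNum (n : nat) : expr := if n is n'.+1 then ECons true (eNum n') else ENil.

Lemma num_num n env : num (eNum n) env = n.
Proof. by elim: n => //= n IH; rewrite num_cons IH. Qed.

Definition eLe a b := EDrop a (ECons true b).
Definition eNot a := EIf a ENil (eNum 1).
Definition eAnd a b := EIf a b ENil.
Definition eEq a b := eAnd (eLe a b) (eLe b a).
Definition eOrs (es : seq expr) := foldr ECat ENil es.
Definition eAnds (es : seq expr) := foldr eAnd (eNum 1) es.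
Definition eNth a i := EHd (EDrop i a).
Definition eBit a := EIf a (ECons true ENil) (ECons false ENil).

Lemma holds_le a b env : holds (eLe a b) env = (num a env <= num b env).
Proof. by rewrite /holds num_drop num_cons subn_gt0 ltnS. Qed.

Lemma num_not a env : num (eNot a) env = ~~ holds a env.
Proof. by rewrite /holds /num /=; case: (ev a env). Qed.

Lemma holds_not a env : holds (eNot a) env = ~~ holds a env.
Proof. by rewrite {1}/holds num_not lt0b. Qed.

Lemma num_if c a b env : num (EIf c a b) env = if holds c env then num a env else num b env.
Proof. by rewrite /holds /num /=; case: (ev c env). Qed.

Lemma holds_and a b env : holds (eAnd a b) env = holds a env && holds b env.
Proof. by rewrite {1}/holds num_if; case: (holds a env). Qed.

Lemma holds_eq a b env : holds (eEq a b) env = (num a env == num b env).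
Proof. by rewrite holds_and !holds_le eqn_leq. Qed.

Lemma holds_cat a b env : holds (ECat a b) env = holds a env || holds b env.
Proof. by rewrite /holds num_cat addn_gt0. Qed.

Lemma holds_ors es env : holds (eOrs es) env = has (fun e => holds e env) es.
Proof. by elim: es => //= e es <-; rewrite holds_cat. Qed.

Lemma holds_ands es env : holds (eAnds es) env = all (fun e => holds e env) es.
Proof. by elim: es => //= e es <-; rewrite holds_and. Qed.

Lemma holds_nth a i env : holds (eNth a i) env = nth false (ev a env) (num i env).
Proof.
rewrite /holds /num /= -{2}[size (ev i env)]addn0 -nth_drop.
by case: (drop _ _) => [|[] v].
Qed.

Lemma ev_bits x n c env (F : nat -> bool) :
  (forall w, size w < num n env -> holds c (upd env x w) = F (size w)) ->
  ev (EFor x n (eBit c)) env = mkseq F (num n env).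
Proof.
rewrite /num /holds /=; elim: (ev n env) => [|bit v IH] // cF.
rewrite [size (_ :: v)]/= -(addn1 (size v)) /mkseq iotaD map_cat /= add0n IH; last first.
  by move=> w w_lt; apply: cF; apply: leqW.
congr (_ ++ _); rewrite -cF // /num.
by case: (ev c _).
Qed.

(* Quotient and remainder of the variable 50 by the variable [z]. *)
Definition divE (z : nat) : expr :=
  EFor 52 (EVar 50)
    (EIf (eLe (EFor 53 (EVar z) (ECons true (EVar 52))) (EVar 50)) (eNum 1) ENil).
Definition modE (z : nat) : expr := EDrop (EFor 54 (divE z) (EVar z)) (EVar 50).

Lemma num_mul x n b env c : (forall w, num b (upd env x w) = c) ->
  num (EFor x n b) env = num n env * c.
Proof. by move=> bE; rewrite (num_for (F := fun=> c)) // sum_nat_const card_ord. Qed.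

(** The quotient is the number of positive multiples of [d] up to [n], which a loop with a
    comparison can count. *)
Lemma sum_leq_div n d : 0 < d -> \sum_(i < n) (d * i.+1 <= n) = n %/ d.
Proof.
move=> d_gt0; have sum_lt q k : \sum_(i < k) (i < q) = minn k q.
  by elim: k => [|k IH]; rewrite ?big_ord0 ?min0n // big_ord_recr /= IH; case: ltnP; lia.
rewrite -[RHS](minn_idPr (leq_div n d)) -sum_lt; apply: eq_bigr => i _.
by rewrite mulnC -leq_divRL.
Qed.

Lemma num_div z env : z < 50 -> 0 < size (env z) ->
  num (divE z) env = size (env 50) %/ size (env z).
Proof.
move=> z_lt z_gt0; rewrite -sum_leq_div //.
apply: (num_for (F := fun i => nat_of_bool (size (env z) * i.+1 <= size (env 50)))) => w _.
rewrite num_if holds_le (num_mul _ (c := (size w).+1)) // !num_var.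
rewrite upd_other; last by lia.
by case: (_ <= _).
Qed.

Lemma num_mod z env : z < 50 -> 0 < size (env z) ->
  num (modE z) env = size (env 50) %% size (env z).
Proof.
move=> z_lt z_gt0; rewrite num_drop (num_mul _ (c := size (env z))).
  by rewrite num_div // num_var {1}(divn_eq (size (env 50)) (size (env z))) addKn.
by move=> w; rewrite num_var upd_other //; lia.
Qed.

(** The input is a list of unary numbers, each closed by a zero; this scan finds the one at index
    [j]. *)
Fixpoint field (x : seq bool) (j : nat) : nat :=
  match x with
  | [::] => 0
  | true :: x' => (j == 0) + field x' j
  | false :: x' => if j is j'.+1 then field x' j' else 0
  end.

Lemma field_sum x j : \sum_(p < size x)
  (nth false x p && (\sum_(q < p) ~~ nth false x q == j) : nat) = field x j.
Proof.
elim: x j => [|b x IH] j; first by rewrite big_ord0.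
rewrite /= big_ord_recl /= big_ord0.
have recl p : \sum_(q < bump 0 p) ~~ nth false (b :: x) q = ~~ b + \sum_(q < p) ~~ nth false x q.
  by rewrite /bump add1n big_ord_recl.
under eq_bigr do rewrite recl.
case: b {recl} => /=; first by rewrite eq_sym -IH.
rewrite add0n; case: j => [|j]; last by rewrite -IH.
by rewrite big1 // => p _; rewrite andbF.
Qed.

Lemma field_nat n x j : field (enc_nat n ++ x) j = if j is j'.+1 then field x j' else n.
Proof.
rewrite /enc_nat cat_rcons; elim: n => //= n IH.
by rewrite IH; case: (j).
Qed.

Lemma field_nats l j : field (flatten (map enc_nat l)) j = nth 0 l j.
Proof.
by elim: l j => [|n l IH] [|j] //=; rewrite field_nat.
Qed.

(* Number of ones in the block of ones of the input (variable 0) whose index is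
   the variable 17: each one counts if it is preceded by that many zeros. *)
Definition fieldE : expr :=
  EFor 15 (EVar 0)
    (EIf (eAnd (eNth (EVar 0) (EVar 15))
               (eEq (EFor 16 (EVar 15) (eNot (eNth (EVar 0) (EVar 16)))) (EVar 17)))
         (eNum 1) ENil).

Lemma num_fieldE env : num fieldE env = field (env 0) (size (env 17)).
Proof.
rewrite -field_sum; apply: (num_for (F := fun p => nat_of_bool
   (nth false (env 0) p && (\sum_(q < p) ~~ nth false (env 0) q == size (env 17))))) => w _.
rewrite num_if holds_and holds_nth holds_eq.
rewrite (num_for (F := fun q => nat_of_bool (~~ nth false (env 0) q))); last first.
  by move=> w' _; rewrite num_not holds_nth.
by rewrite /num /upd /=; case: (_ && _).
Qed.

Section Program.

Variables (Sigma : finType) (a : Sigma).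

(* Is there an edge labelled [l] from the variable 11 to the variable 10? *)
Definition adjE (l : Sigma) : expr :=
  let entry i := ELet 17 (ECat (ECat (EVar 14) (ECat (EVar 14) (EVar 14))) (eNum i)) fieldE in
  EFor 14 (ELet 17 (eNum 3) fieldE)
    (eAnd (eEq (entry 4) (EVar 11))
      (eAnd (eEq (entry 5) (eNum (enum_rank l))) (eEq (entry 6) (EVar 10)))).

Lemma holds_adjE l env (I : instance Sigma) : env 0 = enc_instance I ->
  holds (adjE l) env = adj (i_graph I) l (size (env 11)) (size (env 10)).
Proof.
move=> env0; set G := i_graph I.
have edgesE (G' : graph Sigma) : flatten (map (@enc_edge Sigma) G') = flatten (map enc_nat
    (flatten [seq [:: e_src e; nat_of_ord (enum_rank (e_lab e)); e_tgt e] | e <- G'])).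
  by elim: G' => //= e G' ->; rewrite /enc_edge -!catA.
pose nats := [:: i_s I; i_t I; i_k I; size G] ++
  flatten [seq [:: e_src e; nat_of_ord (enum_rank (e_lab e)); e_tgt e] | e <- G].
have encE : enc_instance I = flatten (map enc_nat nats).
  by rewrite /enc_instance /nats map_cat flatten_cat /= cats0 -!catA edgesE.
(* Four numbers precede the edges and each edge takes three, so edge [i] occupies the fields from
   [4 + 3 i] on. *)
have entry e0 i j : i < size G -> j < 3 -> nth 0 nats (i + (i + i) + (4 + j)) =
    nth 0 [:: e_src (nth e0 G i); nat_of_ord (enum_rank (e_lab (nth e0 G i))); e_tgt (nth e0 G i)] j.
  move=> lt_i lt_j; rewrite addnCA [nth _ _ _]/=.
  elim: (G : seq (edge Sigma)) i lt_i => [|e G' IH] [|i] //= lt_i.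
    by case: (j) lt_j => [|[|[|]]].
  by rewrite addnS addSn !addnS /= IH.
have num_entry i env' : env' 0 = enc_instance I ->
    num (ELet 17 (ECat (ECat (EVar 14) (ECat (EVar 14) (EVar 14))) (eNum i)) fieldE) env' =
    nth 0 nats (size (env' 14) + (size (env' 14) + size (env' 14)) + i).
  move=> env'0; rewrite num_let num_fieldE upd_other // upd_same env'0 encE field_nats.
  by rewrite -[size _]/(num _ _) !num_cat num_num.
have num_size : num (ELet 17 (eNum 3) fieldE) env = size G.
  by rewrite num_let num_fieldE upd_other // upd_same env0 encE field_nats -[size (ev _ _)]/(num _ _) num_num.
pose e0 : edge Sigma := (0, l, 0).
rewrite (holds_for (F := fun i => let e := nth e0 G i in
    [&& e_src e == size (env 11), e_lab e == l & e_tgt e == size (env 10)])); last first.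
  move=> w; rewrite num_size => w_lt; rewrite holds_and holds_eq holds_and !holds_eq !num_entry ?num_num //.
  rewrite upd_same (entry e0 _ 0) // (entry e0 _ 1) // (entry e0 _ 2) //= !num_var.
  by rewrite (inj_eq val_inj) (inj_eq enum_rank_inj).
rewrite num_size; apply/hasP/idP => [[i]|in_G].
  rewrite mem_iota => /andP[_ lt_i] /and3P[/eqP <- /eqP <- /eqP <-].
  by rewrite /adj /e_src /e_lab /e_tgt; case E: (nth _ _ _) => [[x l'] y]; rewrite -E mem_nth.
exists (index (size (env 11), l, size (env 10)) G); first by rewrite mem_iota index_mem.
by rewrite /= nth_index // /e_src /e_lab /e_tgt !eqxx.
Qed.

Definition oddE (e : expr) : expr := ELet 50 e (ELet 26 (eNum 2) (modE 26)).

Lemma num_oddE e env : num (oddE e) env = odd (num e env).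
Proof.
by rewrite !num_let num_mod // upd_same upd_other // upd_same -!/(num _ _) num_num modn2.
Qed.

(* The variable [z] halved as many times as the variable 27 says. *)
Definition halvesE (z : nat) : expr :=
  EIter 20 21 (EVar 27) (EVar z) (EVar z) (ELet 50 (EVar 21) (ELet 26 (eNum 2) (divE 26))).

Lemma num_halvesE z env : z < 20 -> num (halvesE z) env = iter (size (env 27)) half (size (env z)).
Proof.
move=> z_lt; rewrite (num_iter _ _ (F := fun _ acc => minn (size (env z)) acc./2)); last first.
  move=> w acc; congr minn; rewrite !num_let num_div //.
  by rewrite upd_same upd_other // upd_same -!/(num _ _) num_num divn2 num_var upd_same.
rewrite !num_var; move: (size (env 27)) => n.
suff -> m : m <= size (env z) -> (fix loop k acc := if k is k'.+1 then loop k' (minn (size (env z)) acc./2)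
    else acc) n m = iter n half m by [].
elim: n m => //= n IH m m_le; rewrite (minn_idPr _) ?IH -?iterSr //; first by lia.
by lia.
Qed.

Definition compressE (z : nat) : expr :=
  EIter 22 23 (EVar 0) ENil (EVar 1) (ELet 27 (EVar 22)
    (EIf (oddE (halvesE 6)) (ECat (oddE (halvesE z)) (ECat (EVar 23) (EVar 23))) (EVar 23))).

Lemma num_compressE z env : z < 20 -> num (compressE z) env =
  capped_compress (size (env 1)) (size (env 6)) (size (env z)) (size (env 0)) 0.
Proof.
move=> z_lt; set g := size (env 1); set m := size (env 6); set x := size (env z).
rewrite (num_iter _ _ (F := fun n acc =>
    minn g (if odd (iter n half m) then odd (iter n half x) + 2 * acc else acc))); last first.
  move=> w acc; congr minn; rewrite num_let num_if /holds num_oddE lt0b !num_cat.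
  rewrite num_oddE !num_halvesE // !num_var !upd_same.
  have lookup y v v' v'' : y < 20 -> upd (upd (upd env 22 v) 23 v') 27 v'' y = env y.
    by move=> y_lt; rewrite !upd_other //; lia.
  have -> : ev (EVar 22) (upd (upd env 22 w) 23 acc) = w by [].
  have -> : upd (upd (upd env 22 w) 23 acc) 27 w 23 = acc by [].
  by rewrite !lookup // addnn -mul2n.
suff E n acc : (fix loop k acc := if k is k'.+1 then loop k' (minn g
    (if odd (iter k' half m) then odd (iter k' half x) + 2 * acc else acc)) else acc) n acc =
  capped_compress g m x n acc by exact: E.
by elim: n acc => //= n IH acc; rewrite IH.
Qed.

Definition colourE (z : nat) : expr :=
  ELet 9 (ECons true (ECons true (EVar 4)))
    (ELet 50 (EIter 24 25 (compressE z) (EVar 7) (EVar 7) (ELet 50 (EVar 25) (divE 9)))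
      (modE 9)).

Lemma num_colourE z env : 9 < z < 20 -> num (colourE z) env =
  colour (size (env 0)) (size (env 4)) (size (env 1)) (size (env 6)) (size (env 7)) (size (env z)).
Proof.
move=> /andP[z_gt z_lt]; rewrite num_let; set env' := upd env 9 _.
have lookup y : y != 9 -> env' y = env y by exact: upd_other.
have env'9 : size (env' 9) = (size (env 4)).+2 by rewrite /env' upd_same.
rewrite num_let num_mod //.
rewrite upd_same upd_other // env'9 -/(num _ _) /colour; congr (_ %% _).
rewrite (num_iter _ _ (F := fun _ acc => minn (size (env 7)) (acc %/ (size (env 4)).+2))); last first.
  by move=> w acc; rewrite num_let num_div // num_var lookup // upd_same.
rewrite num_compressE // !num_var !lookup //; last by lia.
move: (capped_compress _ _ _ _ _) => n; move: (size (env 7)) (size (env 4)).+2 => c d.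
suff E m : m <= c -> (fix loop k acc := if k is k'.+1 then loop k' (minn c (acc %/ d)) else acc) n m
    = iter n (divn^~ d) m by exact: E.
elim: n m => //= n IH m m_le; have q_le : m %/ d <= c by apply: leq_trans (leq_div _ _) m_le.
by rewrite (minn_idPr q_le) IH // -iterSr.
Qed.

Definition digitE (j : nat) : expr :=
  ELet 50 (iter j (fun e => ELet 50 e (divE 0)) (EVar 5)) (modE 0).

Lemma num_digitE j env : 0 < size (env 0) ->
  num (digitE j) env = digit (size (env 0)) (size (env 5)) j.
Proof.
move=> N_gt0; rewrite num_let num_mod // upd_same upd_other // -/(num _ _); congr (_ %% _).
elim: j => //= j IH; rewrite num_let num_div // upd_same upd_other // -/(num _ _).
by rewrite IH.
Qed.

(** Vertex sets are bit vectors of length [N], the length of the input. Variable 0 thus gives the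
    number of rounds, the range of the vertices and the cut, which never bites. *)
Definition closureE (start step : expr) : expr :=
  EIter 13 12 (EVar 0) (EFor 10 (EVar 0) (eBit start)) (EVar 0)
    (EFor 10 (EVar 0) (eBit (ECat (eNth (EVar 12) (EVar 10))
      (EFor 11 (EVar 0) (eAnd (eNth (EVar 12) (EVar 11)) step))))).

Lemma ev_closureE start step env (X : nat -> bool) (E : nat -> nat -> bool) :
  (forall w, holds start (upd env 10 w) = X (size w)) ->
  (forall i acc w w', holds step (upd (upd (upd (upd env 13 i) 12 acc) 10 w) 11 w') =
     E (size w') (size w)) ->
  ev (closureE start step) env =
  mkseq (iter (size (env 0)) (grow (size (env 0)) E) X) (size (env 0)).
Proof.
move=> startX stepE; set N := size (env 0).
pose body := EFor 10 (EVar 0) (eBit (ECat (eNth (EVar 12) (EVar 10))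
  (EFor 11 (EVar 0) (eAnd (eNth (EVar 12) (EVar 11)) step)))).
have bodyE i Y : take N (ev body (upd (upd env 13 i) 12 (mkseq Y N))) = mkseq (grow N E Y) N.
  rewrite (ev_bits (F := grow N E Y)) ?num_var !upd_other // -/N.
    by rewrite take_oversize // size_mkseq.
  move=> w w_lt; rewrite holds_cat holds_nth /= nth_mkseq //; congr (_ || _).
  rewrite (holds_for (F := fun y => (nth false (mkseq Y N) y) && E y (size w))).
    rewrite num_var !upd_other // -/N; apply: eq_in_has => y.
    by rewrite mem_iota => /andP[_ y_lt]; rewrite nth_mkseq.
  by move=> w' _; rewrite holds_and holds_nth stepE.
have -> : ev (closureE start step) env = iter_loop
    (fun i acc => take N (ev body (upd (upd env 13 i) 12 acc))) (env 0)
    (ev (EFor 10 (EVar 0) (eBit start)) env) by [].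
have -> : ev (EFor 10 (EVar 0) (eBit start)) env = mkseq X N.
  by rewrite (ev_bits (F := X)) // => w _.
suff loopE n Y : iter_loop (fun i acc => take N (ev body (upd (upd env 13 i) 12 acc))) n (mkseq Y N) =
    mkseq (iter (size n) (grow N E) Y) N by exact: loopE.
by elim: n Y => //= b v IH Y; rewrite bodyE IH -iterSr.
Qed.

End Program.

(** * The criterion as an expression *)

Section Decision.

Variables (Sigma : finType) (a : Sigma).

(* Variable 0 holds the input, 1 the table size [g], 2 to 4 the numbers [s],
   [t], [k], and 5 to 7 the guess: the vertices of the [u]-path as digits in
   base [N], the mask, and the table of colours in base [k + 2].  Variable 8
   holds the prefix set as a bit vector, 11 and 10 the ends of an edge. *)
Definition on_wordE (u : seq Sigma) : expr :=
  eOrs [seq eEq (EVar 10) (digitE j) | j <- iota 0 (size u).+1].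

Definition word_walkE (u : seq Sigma) : expr :=
  eAnd (eAnds [seq ELet 11 (digitE j) (ELet 10 (digitE j.+1) (adjE (nth a u j)))
              | j <- iota 0 (size u)])
       (eAnds [seq eAnds [seq eNot (eEq (digitE i) (digitE j)) | i <- iota 0 j]
              | j <- iota 0 (size u).+1]).

Definition allowedE u := ECat (eNot (on_wordE u)) (eEq (EVar 10) (digitE 0)).

Definition prefix_startE u :=
  eAnd (eEq (EVar 10) (EVar 2)) (eAnd (eNot (colourE 10)) (allowedE u)).
Definition prefix_edgeE u :=
  eAnd (adjE a) (eAnd (eEq (colourE 10) (ECons true (colourE 11)))
    (eAnd (eLe (colourE 10) (EVar 4)) (allowedE u))).
Definition suffix_startE (u : seq Sigma) := eEq (EVar 10) (digitE (size u)).
Definition suffix_edgeE u :=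
  eAnd (adjE a) (eAnd (eNot (eNth (EVar 8) (EVar 10))) (eNot (on_wordE u))).

Definition acceptsE u : expr :=
  eAnd (word_walkE u) (ELet 8 (closureE (prefix_startE u) (prefix_edgeE u))
    (eAnd (eNth (EVar 8) (digitE 0))
      (eAnd (ELet 10 (digitE 0) (eEq (colourE 10) (EVar 4)))
        (eNth (closureE (suffix_startE u) (suffix_edgeE u)) (EVar 3))))).

(** The range [N ^ (size u).+1] of the first guess is built by nested loops, one per vertex of the
    word path. It is polynomial because the word is fixed. *)
Definition searchE u : expr :=
  EFor 5 (iter (size u).+1 (fun e => EFor 60 e (EVar 0)) (eNum 1))
    (EFor 6 (ECat (EVar 0) (EVar 0)) (EFor 7 (EVar 1) (acceptsE u))).

Definition field_atE j := ELet 17 (eNum j) fieldE.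

Definition programE (w : seq Sigma) : expr :=
  ELet 2 (field_atE 0) (ELet 3 (field_atE 1) (ELet 4 (field_atE 2)
    (ECat (searchE [::]) (searchE w)))).

Variable I : instance Sigma.
Let X := enc_instance I.
Let G := i_graph I.
Let N := size X.

(** Because of the unary encoding the length of the input exceeds every vertex, so it can serve as
    [N]; the next two lemmas complete this. *)
Lemma start_lt : i_s I < N.
Proof. by rewrite /N /X /enc_instance size_cat size_rcons size_nseq leq_addr. Qed.

Lemma end_lt : i_t I < N.
Proof.
by rewrite /N /X /enc_instance !size_cat !size_rcons !size_nseq; lia.
Qed.

Lemma target_lt x y l : adj G l x y -> y < N.
Proof.
rewrite /adj /N /X /enc_instance !size_cat -/G; elim: (G : seq (edge Sigma)) => //= e G' IH.
rewrite inE size_cat => /orP[/eqP <-|/IH]; last by rewrite !size_rcons; lia.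
by rewrite /enc_edge !size_cat /e_tgt /= !size_rcons !size_nseq; lia.
Qed.

Lemma num_field_atE j env : env 0 = X -> num (field_atE j) env =
  field X j.
Proof. by move=> env0; rewrite num_let num_fieldE upd_same upd_other // env0 -/(num _ _) num_num. Qed.

Lemma field_instance j : j < 3 -> field X j = nth 0 [:: i_s I; i_t I; i_k I] j.
Proof. by case: j => [|[|[|j]]] // _; rewrite /X /enc_instance !field_nat. Qed.

Section Guess.

Variable u : seq Sigma.

Definition setting (env : stack_state) :=
  [/\ env 0 = X, size (env 2) = i_s I, size (env 3) = i_t I & size (env 4) = i_k I].

Lemma setting_upd env z v : 4 < z -> setting env -> setting (upd env z v).
Proof. by move=> z_gt [? ? ? ?]; split; rewrite upd_other //; lia. Qed.

Lemma holds_on_wordE env : setting env ->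
  holds (on_wordE u) env = on_word u (digit N (size (env 5))) (size (env 10)).
Proof.
move=> [env0 _ _ _]; rewrite holds_ors has_map; apply: eq_has => j /=.
by rewrite holds_eq num_digitE env0 ?(leq_ltn_trans _ start_lt).
Qed.

Lemma num_digit env j : setting env -> num (digitE j) env = digit N (size (env 5)) j.
Proof. by move=> [env0 _ _ _]; rewrite num_digitE env0 ?(leq_ltn_trans _ start_lt). Qed.

Lemma holds_word_walkE env : setting env ->
  holds (word_walkE u) env = word_walk G a u (digit N (size (env 5))).
Proof.
move=> set_env; rewrite holds_and !holds_ands !all_map; congr (_ && _); apply: eq_all => j /=.
  rewrite /holds !num_let -/(holds _ _) (@holds_adjE _ _ _ I) -/G; last by case: set_env.
  by rewrite upd_same upd_other // upd_same -!/(num _ _) !num_digit.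
rewrite holds_ands all_map; apply: eq_all => i /=.
by rewrite holds_not holds_eq !num_digit.
Qed.

Lemma holds_allowedE env : setting env ->
  holds (allowedE u) env = allowed u (digit N (size (env 5))) (size (env 10)).
Proof.
by move=> set_env; rewrite holds_cat holds_not holds_on_wordE // holds_eq num_digit.
Qed.

Definition env_colour (env : stack_state) := colour N (i_k I) (size (env 1)) (size (env 6)) (size (env 7)).

Lemma num_colour z env : 9 < z < 20 -> setting env ->
  num (colourE z) env = env_colour env (size (env z)).
Proof. by move=> z_in [env0 _ _ env4]; rewrite num_colourE // env0 env4. Qed.

Lemma ev_prefixE env : setting env ->
  ev (closureE (prefix_startE u) (prefix_edgeE u)) env =
  mkseq (prefix_set G a (i_s I) (i_k I) N u (digit N (size (env 5))) (env_colour env)) N.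
Proof.
move=> set_env; have env0 : env 0 = X by case: set_env.
rewrite (ev_closureE (X := prefix_start (i_s I) u (digit N (size (env 5))) (env_colour env))
  (E := prefix_edge G a (i_k I) u (digit N (size (env 5))) (env_colour env))) ?env0 //.
- move=> w; have set_env' := setting_upd (z := 10) w isT set_env.
  have env2 : size (env 2) = i_s I by case: set_env.
  rewrite holds_and holds_eq holds_and holds_not holds_allowedE //.
  rewrite /holds num_colour // lt0n negbK !num_var /env_colour !upd_same.
  by rewrite [upd _ _ _ 2]upd_other // env2.
- move=> i acc w w'; set env' := upd _ _ _.
  have set_env' : setting env' by do 4!apply: setting_upd => //.
  have env4 : size (env' 4) = i_k I by case: set_env'.
  rewrite holds_and (@holds_adjE _ _ _ I); last by case: set_env'.
  rewrite holds_and holds_eq holds_and holds_le holds_allowedE // num_cons !num_colour //.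
  by rewrite num_var env4.
Qed.

(** The vector records [U] only below [N]. This suffices because [U] is consulted only at heads of
    edges. *)
Lemma ev_suffixE env U : setting env -> env 8 = mkseq U N ->
  (forall x y, adj G a y x -> x < N) ->
  ev (closureE (suffix_startE u) (suffix_edgeE u)) env =
  mkseq (iter N (grow N (fun y x => [&& adj G a y x, ~~ U x & ~~ on_word u (digit N (size (env 5))) x]))
    (suffix_start u (digit N (size (env 5))))) N.
Proof.
move=> set_env env8 adj_lt; have env0 : env 0 = X by case: set_env.
rewrite (ev_closureE (X := suffix_start u (digit N (size (env 5))))
  (E := fun y x => [&& adj G a y x, ~~ U x & ~~ on_word u (digit N (size (env 5))) x])) ?env0 //.
  by move=> w; rewrite holds_eq num_digit // ; apply: setting_upd.
move=> i acc w w'; set env' := upd _ _ _.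
have set_env' : setting env' by do 4!apply: setting_upd => //.
rewrite holds_and (@holds_adjE _ _ _ I); last by case: set_env'.
rewrite holds_and !holds_not holds_nth holds_on_wordE //.
case: (boolP (adj _ _ _ _)) => //= /adj_lt x_lt.
have -> : env' 8 = mkseq U N by rewrite -env8.
by rewrite nth_mkseq.
Qed.

Lemma holds_acceptsE env : setting env -> holds (acceptsE u) env =
  accepts G a (i_s I) (i_t I) (i_k I) N u (digit N (size (env 5))) (env_colour env).
Proof.
move=> set_env; rewrite holds_and holds_word_walkE //; congr (_ && _).
rewrite /holds num_let -/(holds _ _) ev_prefixE //.
set U := prefix_set _ _ _ _ _ _ _ _; set env' := upd _ _ _.
have set_env' : setting env' by apply: setting_upd.
rewrite holds_and holds_nth num_digit // holds_and holds_nth (ev_suffixE (U := U)) //; last first.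
  by move=> x y; apply: target_lt.
have env'3 : size (env' 3) = i_t I by case: set_env'.
rewrite num_var env'3 nth_mkseq ?end_lt // [ev _ _]/= /env' upd_same -/env'.
rewrite nth_mkseq; last by rewrite ltn_mod (leq_ltn_trans _ start_lt).
congr [&& _, _ & _].
have set_env'' : setting (upd env' 10 (ev (digitE 0) env')) by apply: setting_upd.
rewrite /holds num_let -/(holds _ _) holds_eq num_colour // num_var upd_same -/(num _ _) num_digit //.
by case: set_env'' => _ _ _ ->.
Qed.

Lemma holds_searchE env : setting env ->
  holds (searchE u) env <-> search a I N (size (env 1)) u.
Proof.
move=> set_env; have env0 : env 0 = X by case: set_env.
have num_pow j : num (iter j (fun e => EFor 60 e (EVar 0)) (eNum 1)) env = N ^ j.
  elim: j => [|j IH] //=; rewrite (num_mul _ (c := N)) ?IH ?expnSr // => w.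
  by rewrite num_var upd_other // env0.
rewrite (holds_for (F := fun n => has (fun m => has (fun c =>
    accepts G a (i_s I) (i_t I) (i_k I) N u (digit N n) (colour N (i_k I) (size (env 1)) m c))
    (iota 0 (size (env 1)))) (iota 0 (N + N)))); last first.
  move=> w _; rewrite (holds_for (F := fun m => has (fun c =>
    accepts G a (i_s I) (i_t I) (i_k I) N u (digit N (size w))
      (colour N (i_k I) (size (env 1)) m c)) (iota 0 (size (env 1))))); last first.
    move=> w' _; apply: (holds_for (F := fun c =>
      accepts G a (i_s I) (i_t I) (i_k I) N u (digit N (size w))
        (colour N (i_k I) (size (env 1)) (size w') c))) => w'' _.
    by rewrite holds_acceptsE.
  by rewrite num_cat num_var upd_other // env0.
rewrite num_pow; split.
  move=> /hasP[n]; rewrite mem_iota => n_lt /hasP[m]; rewrite mem_iota => m_lt.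
  by move=> /hasP[c]; rewrite mem_iota => c_lt ok; exists n, m, c.
move=> [n [m [c [n_lt m_lt c_lt ok]]]].
apply/hasP; exists n; first by rewrite mem_iota.
apply/hasP; exists m; first by rewrite mem_iota.
by apply/hasP; exists c; first by rewrite mem_iota.
Qed.

End Guess.

Lemma holds_programE w env : env 0 = X ->
  (i_k I).+2 ^ 2 ^ (2 * i_k I) <= size (env 1) -> 2 ^ (2 * i_k I) <= size (env 1) ->
  holds (programE w) env <-> yes_instance a w I.
Proof.
move=> env0 g_table g_cap; rewrite /holds !num_let -/(holds _ _).
set env' := upd _ 4 _.
have set_env' : setting env'.
  split; rewrite /env'.
  - by rewrite !upd_other.
  - by rewrite upd_other // upd_other // upd_same -/(num _ _) num_field_atE // field_instance.
  - by rewrite upd_other // upd_same -/(num _ _) num_field_atE ?field_instance.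
  - by rewrite upd_same -/(num _ _) num_field_atE ?field_instance.
have env'1 : env' 1 = env 1 by rewrite /env' !upd_other.
rewrite holds_cat; split.
  by case/orP => /holds_searchE-/(_ set_env')/search_sound; apply; [left | right].
move=> /(search_complete start_lt target_lt g_table g_cap) found; apply/orP.
by case: found => found; [left | right]; apply/(holds_searchE _ set_env'); rewrite env'1.
Qed.

End Decision.

(** * Running times *)

Definition double_cmd j k :=
  let push := CSeq (CPush k true) (CPush k true) in
  CSeq (CWhile j push push) (transfer k j).

(** Doubling once per symbol on stack [i] gives a power of two, and two runs give the double
    exponential. It cannot be an expression, since those stay polynomial. *)
Definition power_cmd i j k :=
  CSeq (CPush j true) (CWhile i (double_cmd j k) (double_cmd j k)).

Lemma rev_nseq n (x : bool) : rev (nseq n x) = nseq n x.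
Proof.
by elim: n => // n IH; rewrite [nseq _ _]/= rev_cons IH -[x :: _]/(nseq n.+1 x) -addn1 nseqD cats1.
Qed.

Lemma cruns_double (j k : nat) n s : j != k -> s j = nseq n true -> s k = [::] ->
  cruns (double_cmd j k) s (upd s j (nseq (2 * n) true)) (7 * n).+2.
Proof.
move=> jk sj sk; pose st v m := upd (upd s j v) k (nseq m true).
rewrite /double_cmd; set push := CSeq (CPush k true) _.
have step b v m : True -> True /\
    cruns (if b then push else push) (upd (st (b :: v) m) j v) (st v m.+2) 2.
  split=> //; have -> : st v m.+2 =
      upd (upd (upd (st (b :: v) m) j v) k (true :: upd (st (b :: v) m) j v k)) k
          (true :: upd (upd (st (b :: v) m) j v) k (true :: upd (st (b :: v) m) j v k) k).
    rewrite upd_same upd_other 1?eq_sym // /st upd_same.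
    by state_eq.
  by case: (b); apply: (cruns_seq (cruns_push _ _ _) (cruns_push _ _ _)).
have st_j v m : st v m j = v by rewrite /st upd_other // upd_same.
have r1 := @cruns_while nat (fun _ _ => True) st (fun _ _ m => m.+2) j push push 2 st_j step
  (nseq n true) 0 I.
have loopE v m : loop (fun _ _ m => m.+2) v m = 2 * size v + m.
  by elim: v m => //= b v IH m; rewrite IH; lia.
rewrite loopE size_nseq addn0 in r1.
have s_st : s = st (nseq n true) 0 by rewrite /st -sj; state_eq.
rewrite -s_st {s_st} in r1; have r2 := @cruns_transfer k j (st [::] (2 * n)) _.
apply: cruns_eq (cruns_seq r1 (r2 _)) _ _; first by rewrite eq_sym.
- rewrite st_j cats0 /st upd_same rev_nseq.
  by state_eq.
- by rewrite /st upd_same size_nseq; lia.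
Qed.

Lemma cruns_power (i j k : nat) s : i != j -> i != k -> j != k -> s j = [::] -> s k = [::] ->
  cruns (power_cmd i j k) s (upd (upd s i [::]) j (nseq (2 ^ size (s i)) true))
    (16 * (2 ^ size (s i) * 2 ^ size (s i))).
Proof.
move=> ij ik jk sj sk; pose st v m := upd (upd s i v) j (nseq m true).
set Y := 2 ^ size (s i).
pose ok (v : seq bool) m := is_true (2 ^ size v * m <= Y).
have st_i v m : st v m i = v by rewrite /st upd_other // upd_same.
have step (b : bool) v m : ok (b :: v) m -> ok v (2 * m) /\
    cruns (if b then double_cmd j k else double_cmd j k) (upd (st (b :: v) m) i v)
      (st v (2 * m)) (7 * Y).+2.
  rewrite /ok /= expnS => le_Y; split; first by rewrite mulnCA mulnA.
  have -> : (if b then double_cmd j k else double_cmd j k) = double_cmd j k by case: (b).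
  have -> : upd (st (b :: v) m) i v = st v m by rewrite /st; state_eq.
  have r := @cruns_double j k m (st v m) jk.
  apply: cruns_eq (r _ _) _ _.
  - by rewrite /st upd_same.
  - by rewrite /st upd_other 1?eq_sym // upd_other 1?eq_sym.
  - by rewrite /st; state_eq.
  - have : 0 < 2 ^ size v by rewrite expn_gt0.
    by nia.
have ok0 : ok (s i) 1 by rewrite /ok muln1.
have r := cruns_while st_i step ok0.
have loopE v m : loop (fun (_ : bool) (_ : seq bool) m => 2 * m) v m = 2 ^ size v * m.
  by elim: v m => [|b v IH] m; rewrite ?mul1n //= IH expnS; lia.
rewrite loopE muln1 in r.
have s_st : upd s j (true :: s j) = st (s i) 1 by rewrite /st sj; state_eq.
apply: cruns_eq (cruns_seq (cruns_push j true s) _) _ _.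
- by rewrite s_st; exact: r.
- by rewrite /st -/Y; state_eq.
have y_lt : size (s i) < Y by apply: ltn_expl.
have : 2 <= Y \/ size (s i) = 0.
  case: (size (s i)) @Y y_lt {ok st_i step ok0 r s_st} => [|y] Y _; [by right | left].
  by rewrite /Y -{1}(expn1 2) leq_exp2l.
by case=> [Y_ge|->]; nia.
Qed.

(** Applying [k + 2 <= 2 ^ (k + 2)] in the base and again in the exponent bounds the number of
    tables by [2 ^ 2 ^ (3 k + 2)]. *)
Lemma table_bound k : k.+2 ^ 2 ^ (2 * k) <= 2 ^ 2 ^ (3 * k + 3).
Proof.
have le1 : k.+2 <= 2 ^ k.+2 by rewrite ltnW // ltn_expl.
apply: (@leq_trans ((2 ^ k.+2) ^ 2 ^ (2 * k))); first by rewrite leq_exp2r // expn_gt0.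
rewrite -expnM leq_exp2l //; apply: (@leq_trans (2 ^ k.+2 * 2 ^ (2 * k))).
  by rewrite leq_mul2r le1 orbT.
by rewrite -expnD leq_exp2l //; lia.
Qed.

Lemma cap_bound k : 2 ^ (2 * k) <= 2 ^ 2 ^ (3 * k + 3).
Proof.
rewrite leq_exp2l //; apply: leq_trans (ltnW (ltn_expl (3 * k + 3) (isT : 1 < 2))).
by lia.
Qed.

(** [D = 0] gives the table bound [g]. The offset makes room for fixed powers: raising to the power
    [2 C] multiplies the upper exponent by [2 C <= 2 ^ (2 C)]. *)
Definition bound (D k : nat) := 2 ^ 2 ^ (3 * k + 3 + D).

Lemma bound_shift k C : (bound 0 k * bound 0 k) ^ C <= bound (2 * C) k.
Proof.
rewrite /bound addn0 -expnD -expnM leq_exp2l // (expnD 2 (3 * k + 3)).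
set e := 2 ^ (3 * k + 3).
have -> : (e + e) * C = e * (2 * C) by lia.
by rewrite leq_mul2l (ltnW (ltn_expl _ _)) ?orbT.
Qed.

Definition time_exponent (m C1 C2 : nat) : nat :=
  let P := 9 + ((C1 + C2).+1 + (C1 + C2).+1) in 9 + ((P + m) + (P + m)).

(** Every term is a power of [x + g + 2] up to a constant, and [x + g + 2 <= g * g * x]: the sum is
    traded for a product so that the parts in [k] and in the input length separate. *)
Lemma time_bound m C1 C2 x g Y n : 0 < x -> 4 <= g -> Y <= g ->
  n <= (x + 2) ^ C1 + (16 * (Y * Y) + (16 * (g * g) + (x + g + 2) ^ C2)) ->
  n.+1 * (2 * (m + x + n.+1) + 6) <= (g * g * x) ^ time_exponent m C1 C2.
Proof.
move=> x_gt0 g_ge Y_le n_le; rewrite /time_exponent.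
set P := 9 + (_.+1 + _.+1); pose B := x + g + 2; rewrite -/B in n_le.
have B_ge : 2 <= B by exact: leq_addl.
have n_lt : n.+1 <= B ^ P.
  apply: absorb => //.
  have le1 : (x + 2) ^ C1 <= B ^ (C1 + C2).+1.
    apply: (@leq_trans (B ^ C1)); last by apply: leq_expn => //; lia.
    by case: (C1) => // C1'; rewrite leq_exp2r // /B; lia.
  have le2 : B ^ C2 <= B ^ (C1 + C2).+1 by apply: leq_expn => //; lia.
  have le3 : B <= B ^ (C1 + C2).+1 by rewrite -{1}(expn1 B); apply: leq_expn.
  have le4 : g <= B by rewrite /B; lia.
  move: (B ^ (C1 + C2).+1) (B ^ C2) ((x + 2) ^ C1) n_le le1 le2 le3.
  move=> Z Z2 Z1 n_le le1 le2 le3.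
  have gg : g * g <= Z * Z by apply: leq_mul; apply: leq_trans le3.
  have YY : Y * Y <= Z * Z by apply: leq_mul; apply: leq_trans Y_le (leq_trans le4 le3).
  have ZZ : Z <= Z * Z by rewrite leq_pmulr //; apply: leq_trans le3; exact: leq_trans B_ge.
  by move: (g * g) (Y * Y) (Z * Z) gg YY ZZ n_le => *; lia.
apply: (@leq_trans (B ^ (9 + ((P + m) + (P + m))))); last first.
  by rewrite leq_exp2r // /B; nia.
apply: absorb => //; set W := B ^ (P + m).
have nW : n.+1 <= W by apply: leq_trans n_lt _; apply: leq_expn => //; lia.
have xW : x <= W.
  apply: (@leq_trans B); first by rewrite /B; lia.
  by rewrite -{1}(expn1 B); apply: leq_expn => //; rewrite /P; lia.
have mW : m <= W.
  apply: (@leq_trans (2 ^ m)); first by rewrite ltnW // ltn_expl.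
  apply: (@leq_trans (B ^ m)); last by apply: leq_expn => //; lia.
  by case: (m) => // m'; rewrite leq_exp2r.
apply: (@leq_trans (W * (12 * W))); last by rewrite mulnCA leq_mul2r orbT.
by apply: leq_mul => //; lia.
Qed.

(** The input and the table size have stacks of their own; all other variables are empty at the
    start and share stack 2. *)
Definition entry_map (x : nat) := minn x 2.

Lemma represents_entry env s : (forall x, 1 < x -> env x = [::]) ->
  s 0 = env 0 -> s 1 = env 1 -> (forall j, 1 < j -> s j = [::]) ->
  represents entry_map 3 env s.
Proof.
move=> env_nil s0 s1 s_nil; split=> [[|[|x]]|j lt_j] //; last by apply: s_nil; lia.
by rewrite /entry_map (minn_idPr _) // s_nil // env_nil.
Qed.

Lemma bound_computable D : computable (bound D).
Proof.
pose E := ECat (EVar 0) (ECat (EVar 0) (ECat (EVar 0) (eNum (3 + D)))).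
(* Stack 0 is emptied to receive the output, and the last push makes the final test on stack 3
   accept. *)
pose c := CSeq (comp E entry_map 3) (CSeq (clear 0)
  (CSeq (power_cmd 3 4 5) (CSeq (power_cmd 4 0 5) (CPush 3 true)))).
exists (program_machine c 3) => k; set x := nseq k true.
have [C costE] := comp_poly E.
have rep : represents entry_map 3 (input_state x) (input_state x).
  by apply: represents_entry => // j j_gt; rewrite /input_state upd_other //; lia.
have small_x : small (input_state x) (k + 2).
  by move=> z; rewrite /input_state /upd; case: eqP; rewrite ?size_nseq //= leq_addr.
have r1 := costE _ _ _ _ _ (leq_addl _ _) small_x rep.
set s1 := upd _ 3 _ in r1.
have r2 := cruns_clear 0 s1; set s2 := upd s1 0 _ in r2.
have r3 := @cruns_power 3 4 5 s2 isT isT isT erefl erefl; set s3 := upd _ 4 _ in r3.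
have r4 := @cruns_power 4 0 5 s3 isT isT isT erefl erefl; set s4 := upd _ 0 _ in r4.
have r5 := cruns_push 3 true s4.
have [n _ run] := cruns_seq r1 (cruns_seq r2 (cruns_seq r3 (cruns_seq r4 r5))).
have [||//|t [acc out]] := program_outputs (v := bound D k) (r := 3) run; last by exists t.
  have s1_3 : size (s1 3) = 3 * k + 3 + D.
    by rewrite /s1 upd_same -/(num _ _) !num_cat num_num !num_var /input_state upd_same size_nseq; lia.
  rewrite upd_other // /s4 upd_same /s3 upd_same size_nseq /s2 upd_other // s1_3.
  by rewrite /bound.
by rewrite upd_same.
Qed.

Theorem mainTheorem12 (Sigma : finType) (a : Sigma) (w : seq Sigma) :
  FPT_SimplePath a w.
Proof.
(* The length [3 k + 3], with [k] read from the third field of the input. *)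
pose E := ELet 4 (field_atE 2)
  (ECat (EVar 4) (ECat (EVar 4) (ECat (EVar 4) (eNum 3)))).
pose c := CSeq (comp E entry_map 3) (CSeq (power_cmd 3 4 5) (CSeq (power_cmd 4 1 5)
  (comp (programE a w) entry_map 3))).
have [C1 costE] := comp_poly E; have [C2 costP] := comp_poly (programE a w).
pose m := stack_count c 3.
pose C := time_exponent m C1 C2.
exists (bound (2 * C)), C, (program_machine c 3); split; first exact: bound_computable.
move=> I x; set k := i_k I; set g := bound 0 k.
have small_x : small (input_state x) (size x + 2).
  by move=> z; rewrite /input_state /upd; case: eqP; rewrite // leq_addr.
have rep : represents entry_map 3 (input_state x) (input_state x).
  by apply: represents_entry => // j j_gt; rewrite /input_state upd_other //; lia.
have r1 := costE _ _ _ _ _ (leq_addl _ _) small_x rep; set s1 := upd _ 3 _ in r1.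
have s1_3 : size (s1 3) = 3 * k + 3 + 0.
  rewrite /s1 upd_same -/(num _ _) num_let !num_cat num_num !num_var upd_same -/(num _ _).
  by rewrite (num_field_atE (I := I)) // field_instance //=; lia.
have r2 := @cruns_power 3 4 5 s1 isT isT isT erefl erefl; set s2 := upd _ 4 _ in r2.
have s2_4 : size (s2 4) = 2 ^ (3 * k + 3 + 0) by rewrite /s2 upd_same size_nseq s1_3.
have r3 := @cruns_power 4 1 5 s2 isT isT isT erefl erefl; set s3 := upd _ 1 _ in r3.
have s3_1 : s3 1 = nseq g true by rewrite /s3 upd_same s2_4.
pose env := upd (input_state x) 1 (nseq g true).
pose B := size x + g + 2.
have B_ge : 2 <= B by exact: leq_addl.
have small_env : small env B.
  apply: small_upd; last by rewrite size_nseq /B; lia.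
  by apply: small_leq small_x; rewrite /B; lia.
(* The two power commands have used up stacks 3 and 4, so the stacks from 3 on are free again. *)
have rep3 : represents entry_map 3 env s3.
  apply: represents_entry => // [[|[|j]]|[|[|[|[|[|j]]]]]] //.
have r4 := costP _ _ _ _ _ B_ge small_env rep3.
have [n n_le run] := cruns_seq r1 (cruns_seq r2 (cruns_seq r3 r4)).
apply: program_decides run _ _; last first.
  rewrite upd_same -(holds_programE a w (I := I) (env := env)) //.
  - by rewrite /holds /num; case: (ev _ _).
  - by rewrite size_nseq; have := table_bound k; rewrite /g /bound addn0.
  - by rewrite size_nseq; have := cap_bound k; rewrite /g /bound addn0.
rewrite s2_4 s1_3 -/(bound 0 k) -/g in n_le.
have Y_le : 2 ^ (3 * k + 3 + 0) <= g by rewrite /g /bound ltnW // ltn_expl.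
have g_ge : 4 <= g.
  rewrite /g /bound -[4]/(2 ^ 2) leq_exp2l // -{1}(expn1 2) leq_exp2l //.
  by rewrite addn0 addnS.
have x_gt0 : 0 < size x by apply: leq_ltn_trans (start_lt I).
(* The factor [(g * g) ^ C] goes into [bound (2 * C) k], and the power of the input length is the
   polynomial part. *)
apply: leq_trans (time_bound m x_gt0 g_ge Y_le n_le) _; rewrite -/C expnMn.
apply: leq_mul; first exact: bound_shift.
by rewrite leq_exp2r // leq_addr.
Qed.
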